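(* Let $\mu$ be a partition of $m$ and let $\nu$ be a partition of $n$. The lexicographically least partition labelling a Specht module occurring as a summand of $H_\mu^\nu$ is obtained as follows. If $m$ is odd, it is the join, over the parts $\nu_i$ of $\nu$, of the lexicographically least partitions labelling Specht modules occurring as summands of $H_\mu^{(\nu_i)}$. If $m$ is even, it is the join, over the parts $\nu'_i$ of the conjugate partition $\nu'$, of the lexicographically least partitions labelling Specht modules occurring as summands of $H_\mu^{(1^{\nu'_i})}$.
   Context: Here $m,n$ are positive integers. $S^\lambda$ is the Specht module over $\mathbb{Q}$ labelled by the partition $\lambda$ (irreducible, with $S^{(r)}$ the trivial $\mathbb{Q}S_r$-module). The wreath product $S_m\wr S_n$ acts as a transitive imprimitive subgroup of $S_{mn}$. For a $\mathbb{Q}S_m$-module $W$ and a $\mathbb{Q}S_n$-module $Z$, $W\oslash Z$ is the $\mathbb{Q}(S_m\wr S_n)$-module $W^{\otimes n}\otimes Z$, where $S_m^n$ acts factorwise on $W^{\otimes n}$ and trivially on $Z$, and $S_n$ acts by permuting the tensor factors of $W^{\otimes n}$ (no signs) and by its given action on $Z$. For partitions $\mu$ of $m$ and $\nu$ of $n$ (any $m,n\ge1$), the generalized Foulkes module is $H_\mu^\nu=(S^\mu\oslash S^\nu)\uparrow_{S_m\wr S_n}^{S_{mn}}$. The join of partitions $\lambda$ and $\tilde\lambda$ is the partition whose multiset of parts is the union (with multiplicities added) of the multisets of parts of $\lambda$ and $\tilde\lambda$. *)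

(* Defs.v *)
From HB Require Import structures.
From mathcomp Require Import all_boot all_order all_fingroup all_algebra.
From mathcomp Require Import all_character.

Set Implicit Arguments.
Unset Strict Implicit.
Unset Printing Implicit Defensive.

Import GroupScope GRing.Theory.
Local Open Scope ring_scope.

(* All modules are finite-dimensional over [rat], given by matrix              *)
(* representations acting on row vectors from the right, as permutations       *)
(* compose from left to right: (s * t) x = t (s x).                            *)

(** * Partitions *)

Definition is_partition (n : nat) (s : seq nat) : bool :=
  [&& sorted geq s, 0%N \notin s & sumn s == n].

Definition conj_part (s : seq nat) : seq nat :=
  [seq count (fun p => (j < p)%N) s | j <- iota 0 (head 0%N s)].

Definition join_parts (ss : seq (seq nat)) : seq nat := sort geq (flatten ss).

(* [seqlexi] carries the lexicographic order, a proper prefix being smaller. *)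
Definition lex_le (s t : seq nat) : bool := ((s : seqlexi nat) <= t)%O.

(** * Specht modules *)

Section FinMatrix.

Variables (I J : finType).

Definition fin_mx (f : I -> J -> rat) : 'M[rat]_(#|I|, #|J|) :=
  \matrix_(i, j) f (enum_val i) (enum_val j).

End FinMatrix.

Lemma fin_mxM (I J K : finType) (f : I -> J -> rat) (g : J -> K -> rat) :
  fin_mx f *m fin_mx g = fin_mx (fun i k => \sum_j f i j * g j k).
Proof.
apply/matrixP=> i k; rewrite !mxE [RHS](reindex (@enum_val J predT)).
  by apply: eq_bigr => j _; rewrite !mxE.
exact/onW_bij/enum_val_bij.
Qed.

Lemma fin_mx1 (I : finType) : fin_mx (fun i j : I => (i == j)%:R) = 1%:M.
Proof. by apply/matrixP=> i j; rewrite !mxE (inj_eq enum_val_inj). Qed.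

Lemma eq_fin_mx (I J : finType) (f g : I -> J -> rat) :
  (forall i j, f i j = g i j) -> fin_mx f = fin_mx g.
Proof. by move=> eqfg; apply/matrixP=> i j; rewrite !mxE eqfg. Qed.

Section Specht.

Variables (T : finType) (lam : seq nat).

(* A filling of a shape by the points of [T] is encoded by the map sending    *)
(* each point to its position; [s] then replaces every entry [x] by [s x].    *)
Definition relabel (C : finType) (f : {ffun T -> C}) (s : {perm T}) :
  {ffun T -> C} := [ffun x => f (s^-1 x)%g].

Lemma relabel1 (C : finType) (f : {ffun T -> C}) : relabel f 1 = f.
Proof. by apply/ffunP=> x; rewrite ffunE invg1 perm1. Qed.

Lemma relabelM (C : finType) (f : {ffun T -> C}) s r :
  relabel f (s * r) = relabel (relabel f s) r.
Proof. by apply/ffunP=> x; rewrite !ffunE invMg permM. Qed.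

(* A tabloid is determined by the row in which each point lies. *)
Definition is_tabloid (f : {ffun T -> 'I_(size lam)}) : bool :=
  [forall i, #|[set x | f x == i]| == nth 0%N lam i].

Definition tabloid := {f : {ffun T -> 'I_(size lam)} | is_tabloid f}.

Definition is_tableau (t : {ffun T -> 'I_(size lam) * 'I_(head 0%N lam)}) :=
  injectiveb t && [forall c, (c \in codom t) == (c.2 < nth 0 lam c.1)%N].

Definition tableau :=
  {t : {ffun T -> 'I_(size lam) * 'I_(head 0%N lam)} | is_tableau t}.

Lemma relabel_is_tabloid f s : is_tabloid f -> is_tabloid (relabel f s).
Proof.
move/forallP=> fP; apply/forallP=> i; rewrite -(eqP (fP i)).
rewrite -[X in _ == X](card_imset _ (@perm_inj _ s)); apply/eqP/eq_card=> x.
rewrite !inE ffunE; apply/eqP/imsetP=> [<-|[y + ->]].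
  by exists (s^-1 x)%g; rewrite ?inE ?permKV.
by rewrite inE permK => /eqP.
Qed.

Lemma relabel_is_tableau t s : is_tableau t -> is_tableau (relabel t s).
Proof.
case/andP=> /injectiveP t_inj /forallP tP; apply/andP; split.
  by apply/injectiveP=> x y; rewrite !ffunE => /t_inj /perm_inj.
apply/forallP=> c; rewrite -(eqP (tP c)); apply/eqP.
apply/codomP/codomP=> -[x ->]; first by exists (s^-1 x)%g; rewrite ffunE.
by exists (s x); rewrite ffunE permK.
Qed.

(* The Young permutation module M^lam. *)
Definition young_mx (s : {perm T}) : 'M[rat]_#|{: tabloid}| :=
  fin_mx (fun f g : tabloid => (relabel (val f) s == val g)%:R).

Lemma young_mx_repr : mx_repr [set: {perm T}] young_mx.
Proof.
split=> [|s r _ _].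
  by rewrite -fin_mx1; apply: eq_fin_mx => f g; rewrite relabel1.
rewrite /young_mx fin_mxM; apply: eq_fin_mx => f h; rewrite relabelM.
pose g : tabloid := Sub (relabel (val f) s) (relabel_is_tabloid s (valP f)).
rewrite (bigD1 g) //= eqxx mul1r big1 ?addr0 // => g' neq_g'.
case: eqP => [Dg'|_]; last by rewrite mul0r.
by rewrite -val_eqE /= Dg' eqxx in neq_g'.
Qed.

Definition young_repr : mx_representation rat [set: {perm T}] _ :=
  MxRepresentation young_mx_repr.

Definition row_map (t : {ffun T -> 'I_(size lam) * 'I_(head 0%N lam)}) :
  {ffun T -> 'I_(size lam)} := [ffun x => (t x).1].

Definition col_stab (t : {ffun T -> 'I_(size lam) * 'I_(head 0%N lam)}) :
  {set {perm T}} := [set s : {perm T} | [forall x, (t (s x)).2 == (t x).2]].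

(* The polytabloid of [t]: the sum of sgn(s) {t}s over the column stabiliser. *)
Definition polytabloid (t : tableau) : 'rV[rat]_#|{: tabloid}| :=
  \row_j \sum_(s in col_stab (val t))
    (-1) ^+ odd_perm s * (relabel (row_map (val t)) s == val (enum_val j))%:R.

Definition specht_space : 'M[rat]_#|{: tabloid}| :=
  << \matrix_(i < #|{: tableau}|) polytabloid (enum_val i) >>%MS.

Lemma polytabloid_young (t : tableau) s :
  polytabloid t *m young_mx s
    = polytabloid (Sub (relabel (val t) s) (relabel_is_tableau s (valP t))).
Proof.
apply/rowP=> j; rewrite !mxE /=; set h : tabloid := enum_val j.
pose g : tabloid := Sub (relabel (val h) s^-1%g) (relabel_is_tabloid s^-1%g (valP h)).
have gs : relabel (val g) s = val h by rewrite /= -relabelM mulVg relabel1.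
rewrite (bigD1 (enum_rank g)) //= !mxE enum_rankK gs eqxx mulr1.
rewrite [X in _ + X]big1 ?addr0 => [|i neq_ig]; last first.
  rewrite !mxE; case: eqP => [Dh|_]; last by rewrite mulr0.
  case/eqP: neq_ig; apply: enum_val_inj; rewrite enum_rankK.
  by apply: val_inj; rewrite /= -Dh -relabelM mulgV relabel1.
rewrite [RHS](reindex_inj (conjg_inj s)) /=; apply: eq_big => [u|u _].
  rewrite !inE; apply/forallP/forallP=> uP x.
    by rewrite !ffunE conjgE !permM permK.
  by have:= uP (s x); rewrite !ffunE conjgE !permM !permK.
rewrite odd_permJ; congr (_ * (nat_of_bool _)%:R).
have -> : row_map (relabel (val t) s) = relabel (row_map (val t)) s.
  by apply/ffunP=> x; rewrite !ffunE.
rewrite -relabelM conjgE !mulgA mulgV mul1g relabelM.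
apply/eqP/eqP=> [->|<-]; last by rewrite -relabelM mulgV relabel1.
by rewrite -relabelM mulVg relabel1.
Qed.

Lemma specht_module : mxmodule young_repr specht_space.
Proof.
apply/mxmoduleP=> s _; rewrite (eqmxMr _ (genmxE _)) genmxE.
apply/row_subP=> i; rewrite row_mul rowK polytabloid_young.
move: (Sub _ _ : tableau) => t'.
have <- : row (enum_rank t') (\matrix_i0 polytabloid (enum_val i0))
    = polytabloid t' by rewrite rowK enum_rankK.
exact: row_sub.
Qed.

(* The Specht module S^lam, over the symmetric group on the point set [T].    *)
Definition specht : representation rat [set: {perm T}] :=
  Representation (submod_repr specht_module).

End Specht.

(** * Induction *)

Section Induced.

Variables (gT : finGroupType) (H G : {group gT}) (sHG : H \subset G).
Variables (d : nat) (rH : mx_representation rat H d).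

(* The induced module is V (x)_(QH) QG, with basis v_i (x) r_C, where r_C     *)
(* represents the right coset C of H in G. If r_C g = h r_D with h in H then  *)
(* (v (x) r_C) g = v h (x) r_D.                                               *)
Definition right_coset := {C : {set gT} | C \in rcosets H G}.

Definition ind_mx (g : gT) : 'M[rat]_#|{: right_coset * 'I_d}| :=
  fin_mx (fun Ci Dj : right_coset * 'I_d =>
    let h := (repr (val Ci.1) * g * (repr (val Dj.1))^-1)%g in
    if h \in H then rH h Ci.2 Dj.2 else 0).

Lemma repr_right_coset (C : right_coset) :
  repr (val C) \in G /\ val C = H :* repr (val C).
Proof.
case: C => _ /= /rcosetsP[x Gx ->]; rewrite rcoset_repr; split=> //.
have: repr (H :* x) \in H :* x by apply: mem_repr (rcoset_refl H x).
by case/rcosetP=> h Hh ->; rewrite groupM // (subsetP sHG).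
Qed.

Lemma ind_mx_repr : mx_repr G ind_mx.
Proof.
split=> [|x y Gx Gy].
  rewrite -fin_mx1; apply: eq_fin_mx => -[C i] [D j] /=.
  have [[_ DC] [_ DD]] := (repr_right_coset C, repr_right_coset D).
  rewrite mulg1 -mem_rcoset -DD xpair_eqE.
  have -> : (repr (val C) \in val D) = (C == D).
    apply/idP/eqP=> [CD|<-]; last by rewrite {2}DC rcoset_refl.
    apply: val_inj; rewrite DC DD; apply: rcoset_eqP.
    by rewrite -DD.
  by case: eqP => //= ->; rewrite mulgV repr_mx1 mxE.
rewrite /ind_mx fin_mxM; apply: eq_fin_mx => -[C i] [D j] /=.
have [[GC DC] [GD DD]] := (repr_right_coset C, repr_right_coset D).
have EP : H :* (repr (val C) * x) \in rcosets H G.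
  by apply/rcosetsP; exists (repr (val C) * x)%g; rewrite ?groupM.
pose E : right_coset := exist (fun B => B \in rcosets H G) _ EP.
rewrite -(pair_bigA _ (fun (F : right_coset) k =>
  (if (repr (val C) * x * (repr (val F))^-1)%g \in H
   then rH (repr (val C) * x * (repr (val F))^-1)%g i k else 0)
  * (if (repr (val F) * y * (repr (val D))^-1)%g \in H
   then rH (repr (val F) * y * (repr (val D))^-1)%g k j else 0))) /=.
have [_ DE] := repr_right_coset E.
have HE : (repr (val C) * x * (repr (val E))^-1)%g \in H.
  by rewrite -mem_rcoset -DE rcoset_refl.
rewrite (bigD1 E) //= [X in _ = _ + X]big1 ?addr0 => [|F neqFE]; last first.
  apply: big1 => k _; case: ifP => [|_]; last by rewrite mul0r.
  have [_ DF] := repr_right_coset F.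
  rewrite -mem_rcoset -DF => CxF; case/eqP: neqFE; apply: val_inj => /=.
  by rewrite DF; apply/esym/rcoset_eqP; rewrite -DF.
move: HE => /=; set e := repr (H :* _) => HE; rewrite HE.
have -> : (repr (val C) * (x * y) * (repr (val D))^-1
  = (repr (val C) * x * e^-1) * (e * y * (repr (val D))^-1))%g.
  by rewrite !mulgA mulgKV.
rewrite groupMl //; case: ifP => [HeD|_].
  by rewrite repr_mxM // mxE.
by rewrite big1 // => k _; rewrite mulr0.
Qed.

Definition ind_repr : representation rat G :=
  Representation (MxRepresentation ind_mx_repr).

End Induced.

(** * The imprimitive wreath product *)

Definition perm_of_ffun (T : finType) (f : {ffun T -> T}) : {perm T} :=
  insubd (1%g : {perm T}) f.

Lemma perm_of_ffunE (T : finType) (f : {ffun T -> T}) :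
  injective f -> perm_of_ffun f =1 f.
Proof.
move=> /injectiveP f_inj x; rewrite -pvalE /perm_of_ffun.
by rewrite [pval _](insubdK (1%g : {perm T}) f_inj).
Qed.

Section Wreath.

Variables (m n : nat).

(* S_(m n) is the symmetric group on ['I_n * 'I_m], whose [n] blocks of size  *)
(* [m] are the fibres of the first projection.                                *)
Definition wreath_set : {set {perm 'I_n * 'I_m}} :=
  [set s : {perm 'I_n * 'I_m} | [forall x, forall y, (x.1 == y.1) ==> ((s x).1 == (s y).1)]].

Lemma wreathP (s : {perm 'I_n * 'I_m}) :
  reflect (forall x y, x.1 = y.1 -> (s x).1 = (s y).1) (s \in wreath_set).
Proof.
rewrite inE; apply: (iffP forallP) => [sP x y /eqP xy | sP x].
  by have /forallP/(_ y) := sP x; rewrite xy => /eqP.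
by apply/forallP=> y; apply/implyP=> /eqP /sP ->.
Qed.

Lemma wreath_group_set : group_set wreath_set.
Proof.
apply/group_setP; split=> [|s r /wreathP sP /wreathP rP]; apply/wreathP=> x y.
  by rewrite !perm1.
by move/sP/rP; rewrite !permM.
Qed.

Canonical wreath : {group {perm 'I_n * 'I_m}} := Group wreath_group_set.

(* For [0 < m], an element [s] of the wreath product sends [(i, x)] to        *)
(* [(block_perm s i, fibre_perm s i x)].                                                   *)
Definition block_fun (s : {perm 'I_n * 'I_m}) : {ffun 'I_n -> 'I_n} :=
  [ffun i => if [pick x : 'I_m] is Some x then (s (i, x)).1 else i].

Definition block_perm (s : {perm 'I_n * 'I_m}) : 'S_n := perm_of_ffun (block_fun s).

Definition fibre_fun (s : {perm 'I_n * 'I_m}) (i : 'I_n) : {ffun 'I_m -> 'I_m} :=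
  [ffun x => (s (i, x)).2].

Definition fibre_perm (s : {perm 'I_n * 'I_m}) (i : 'I_n) : 'S_m :=
  perm_of_ffun (fibre_fun s i).

Lemma block_permE s i : s \in wreath -> block_perm s i = block_fun s i.
Proof.
move=> sW; have /wreathP sVP : s^-1%g \in wreath by rewrite groupV.
rewrite perm_of_ffunE // => i1 i2; rewrite !ffunE; case: pickP => // x _ eq_s.
have := sVP (s (i1, x)) (s (i2, x)); rewrite eq_s !permK; exact.
Qed.

Lemma wreathE s i x :
  s \in wreath -> s (i, x) = (block_perm s i, fibre_perm s i x).
Proof.
move=> sW; rewrite block_permE // !ffunE.
have sP := wreathP _ sW.
case: pickP => [y _|/(_ x)//]; rewrite [s (i, x)]surjective_pairing.
rewrite (sP (i, x) (i, y)) //; congr (_, _).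
have s_inj : injective (fibre_fun s i).
  move=> x1 x2; rewrite !ffunE => eq_s.
  have: s (i, x1) = s (i, x2).
    by rewrite [LHS]surjective_pairing eq_s (sP _ (i, x2)) // -surjective_pairing.
  by move/perm_inj => [].
by rewrite /fibre_perm perm_of_ffunE // ffunE.
Qed.

Lemma block_perm1 : block_perm 1 = 1%g.
Proof.
apply/permP=> i; rewrite block_permE ?group1 // ffunE perm1.
by case: pickP => // x _; rewrite perm1.
Qed.

Lemma block_permM : {in wreath &, {morph block_perm : s r / (s * r)%g}}.
Proof.
move=> s r sW rW; apply/permP=> i; rewrite permM !block_permE ?groupM // !ffunE.
by case: pickP => // x _; rewrite permM (wreathP _ rW _ ((s (i, x)).1, x)).
Qed.

Lemma fibre_perm1 i : fibre_perm 1 i = 1%g.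
Proof.
apply/permP=> x; have := wreathE i x (group1 wreath).
by rewrite !perm1 => -[_ <-].
Qed.

Lemma fibre_permM i : {in wreath &, forall s r,
  fibre_perm (s * r) i = (fibre_perm s i * fibre_perm r (block_perm s i))%g}.
Proof.
move=> s r sW rW; apply/permP=> x; have := wreathE i x (groupM sW rW).
by rewrite !permM (wreathE _ _ sW) (wreathE _ _ rW) => -[_ ->].
Qed.

(* The basis of W^(x)n consists of the tensors indexed by ['I_n -> 'I_d]; [s] *)
(* moves the [i]-th factor, acted on by [fibre_perm s i], to the place        *)
(* [block_perm s i].                                                          *)
Definition tens_pow_mx d (rW : mx_representation rat [set: 'S_m] d) s :
    'M[rat]_#|{ffun 'I_n -> 'I_d}| :=
  fin_mx (fun a b : {ffun 'I_n -> 'I_d} =>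
    \prod_i rW (fibre_perm s i) (a i) (b (block_perm s i))).

Lemma tens_pow_mx_repr d (rW : mx_representation rat [set: 'S_m] d) :
  mx_repr wreath (tens_pow_mx rW).
Proof.
split=> [|s r sW rW'].
  rewrite -fin_mx1; apply: eq_fin_mx => a b.
  under eq_bigr do rewrite fibre_perm1 repr_mx1 block_perm1 perm1 mxE.
  have [->|neq_ab] := eqVneq a b; first by apply: big1 => i _; rewrite eqxx.
  have [i neq_i] : exists i, a i != b i.
    apply/existsP; apply: contraNT neq_ab; rewrite negb_exists => /forallP eqab.
    by apply/eqP/ffunP=> i; apply/eqP; rewrite -[_ == _]negbK.
  by rewrite (bigD1 i) //= (negPf neq_i) mul0r.
rewrite /tens_pow_mx fin_mxM; apply: eq_fin_mx => a b.
under eq_bigr do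
  rewrite fibre_permM // repr_mxM ?inE // mxE block_permM // permM.
rewrite bigA_distr_bigA /= (reindex (fun c : {ffun 'I_n -> 'I_d} =>
  [ffun i => c (block_perm s i)])) /=; last first.
  exists (fun c : {ffun 'I_n -> 'I_d} => [ffun i => c ((block_perm s)^-1%g i)]).
    by move=> c _; apply/ffunP=> i; rewrite !ffunE permKV.
  by move=> c _; apply/ffunP=> i; rewrite !ffunE permK.
apply: eq_bigr => c _; rewrite [X in _ = _ * X](reindex_inj (@perm_inj _ (block_perm s))).
by rewrite -big_split; apply: eq_bigr => i _; rewrite !ffunE.
Qed.

Definition tens_pow_repr d (rW : mx_representation rat [set: 'S_m] d) :=
  MxRepresentation (tens_pow_mx_repr rW).

Lemma infl_mx_repr e (rZ : mx_representation rat [set: 'S_n] e) :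
  mx_repr wreath (fun s => rZ (block_perm s)).
Proof.
split=> [|s r sW rW]; first by rewrite block_perm1 repr_mx1.
by rewrite block_permM // repr_mxM ?inE.
Qed.

Definition infl_repr e (rZ : mx_representation rat [set: 'S_n] e) :=
  MxRepresentation (infl_mx_repr rZ).

(* The module W (/) Z. *)
Definition oslash (W : representation rat [set: 'S_m])
    (Z : representation rat [set: 'S_n]) : representation rat wreath :=
  Representation (prod_repr (tens_pow_repr W) (infl_repr Z)).

End Wreath.

(** * Generalized Foulkes modules *)

Definition foulkes (m n : nat) (mu nu : seq nat) :
    representation rat [set: {perm 'I_n * 'I_m}] :=
  ind_repr (subsetT (wreath m n)) (oslash (specht 'I_m mu) (specht 'I_n nu)).

Definition is_summand (gT : finGroupType) (G : {group gT})
    (S V : representation rat G) : Prop :=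
  exists W : representation rat G, mx_rsim V (dadd_grepr S W).

Definition occurs (T : finType) (V : representation rat [set: {perm T}])
    (lam : seq nat) : Prop :=
  is_partition #|T| lam /\ is_summand (specht T lam) V.

(* [lam] is the lexicographically least partition such that S^lam occurs as a *)
(* summand of H_mu^nu, where |mu| = m and |nu| = n.                           *)
Definition lex_least_constituent (m n : nat) (mu nu lam : seq nat) : Prop :=
  occurs (foulkes m n mu nu) lam /\
  forall kap : seq nat, occurs (foulkes m n mu nu) kap -> lex_le lam kap.

(* Main.v *)
(* Encode a partition s by its cost, the sum over its parts k of
   1 + N + ... + N^(k-1), for N larger than |s|.  Comparing costs is comparing
   partitions lexicographically, and the cost of a join is the sum of the costs.
   A colouring f of the points is present in a module X when some nonzero
   vector of X is multiplied by the sign under the colour-preserving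
   permutations; its cost is the sum of the N^(f x).  A constituent S^lam makes
   the column colouring of a lam-tableau present, and conversely a present
   colouring of least cost is the column colouring of a constituent: recolouring
   a point with a smaller colour kills the vector v, which determines the action
   on v of the central element z = sum of all transpositions.  Comparing with the
   action of z on a row-invariant vector of the module generated by v, the two
   scalars can only agree if rows and columns form a Young diagram.

   For the induced module H_mu^nu, a present colouring amounts to a colouring of
   the n blocks by atoms (a colouring of one block together with an index of a
   basis vector of the corresponding space of S^mu), such that S^nu has a vector
   transforming by sgn^m under the permutations of blocks preserving the atoms.
   The atoms must be distinct along each row (m odd) or column (m even) of some
   nu-tableau, and the least cost is attained by using, in each such line of
   length r, the r cheapest atoms.  Hence the least cost is additive over lines. *)
From HB Require Import structures.
Require Import Defs.
From mathcomp Require Import all_boot all_order all_fingroup all_algebra.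
From mathcomp Require Import all_character ring zify.

Set Implicit Arguments.
Unset Strict Implicit.
Unset Printing Implicit Defensive.

Import GroupScope GRing.Theory Num.Theory.
Local Open Scope ring_scope.

(** * Vectors on which a Young subgroup acts by a linear character *)

Section SignPower.

Variable T : finType.
Implicit Types s r : {perm T}.

(** The boolean [e] selects the sign ([true]) or the trivial character ([false]), so that columns
    and rows, and later the twist by the parity of [m], share one set of lemmas. *)
Definition sgp (e : bool) (s : {perm T}) : rat := (-1) ^+ (e && odd_perm s).

Lemma sgp1 e : sgp e 1 = 1.
Proof. by rewrite /sgp odd_perm1 andbF. Qed.

Lemma sgpM e s r : sgp e (s * r)%g = sgp e s * sgp e r.
Proof. by case: e; rewrite /sgp ?mulr1 //= odd_permM signr_addb. Qed.

Lemma sgpK e s : sgp e s * sgp e s = 1.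
Proof. by rewrite -expr2 sqrr_sign. Qed.

Lemma sgp_tperm e x y : sgp e (tperm x y) = (-1) ^+ (e && (x != y)).
Proof. by rewrite /sgp odd_tperm. Qed.

Lemma sgpJ e s r : sgp e (s ^ r)%g = sgp e s.
Proof. by rewrite /sgp odd_permJ. Qed.

End SignPower.

Section YoungSubgroup.

Variables (T : finType) (C : eqType).
Implicit Types (f : T -> C) (s : {perm T}).

Definition stab f : {set {perm T}} := [set s : {perm T} | [forall x, f (s x) == f x]].

Lemma stabP f s : reflect (forall x, f (s x) = f x) (s \in stab f).
Proof. by rewrite inE; apply: (iffP forallP) => h x; apply/eqP. Qed.

Lemma stab_group_set f : group_set (stab f).
Proof.
apply/group_setP; split=> [|s r /stabP sP /stabP rP]; apply/stabP=> x.
  by rewrite perm1.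
by rewrite permM rP sP.
Qed.

Canonical stab_group f := Group (stab_group_set f).

Lemma stab_tperm f x y : f x = f y -> tperm x y \in stab f.
Proof. by move=> fxy; apply/stabP=> z; case: tpermP => [->|->|]. Qed.

Lemma stab_comp f s r : (r \in stab (f \o s)) = (r ^ s \in stab f)%g.
Proof.
apply/stabP/stabP=> rP x.
  by have := rP ((s^-1)%g x); rewrite /= conjgE !permM permKV.
by have := rP (s x); rewrite /= conjgE !permM permK.
Qed.

Lemma stab_inj f : injective f -> stab f = 1%g.
Proof.
move=> f_inj; apply/setP=> s; rewrite in_set1; apply/stabP/eqP=> [sP|-> x].
  by apply/permP=> x; rewrite perm1; apply: f_inj.
by rewrite perm1.
Qed.

End YoungSubgroup.

Lemma eq_stab (T : finType) (C D : eqType) (f : T -> C) (g : T -> D) :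
  (forall x y, (f x == f y) = (g x == g y)) -> stab f = stab g.
Proof. by move=> fg; apply/setP=> s; rewrite !inE; apply: eq_forallb => x. Qed.

Section SemiInvariant.

Variables (T : finType) (G : {group {perm T}}) (d : nat).
Variables (rG : mx_representation rat G d) (e : bool).

Section OneColouring.

Variables (C : eqType) (f : T -> C).

Definition semi_inv m (v : 'M[rat]_(m, d)) : Prop :=
  forall s, s \in G -> s \in stab f -> v *m rG s = sgp e s *: v.

(** For a tableau this is the column antisymmetrizer ([e = true]) or the row symmetrizer
    ([e = false]). Up to the nonzero factor [#|G :&: stab f|] it projects onto the semi-invariant
    vectors, which makes their existence decidable. *)
Definition symm_mx : 'M[rat]_d := \sum_(s in G :&: stab f) sgp e s *: rG s.

Definition has_semi_inv : bool := symm_mx != 0.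

Lemma symm_mxM s : s \in G -> s \in stab f -> symm_mx *m rG s = sgp e s *: symm_mx.
Proof.
move=> Gs fs; rewrite /symm_mx mulmx_suml scaler_sumr.
have GIs : s \in G :&: stab f by rewrite inE Gs.
rewrite [RHS](reindex_acts 'R _ GIs) ?astabsR //=; apply: eq_bigr => r.
case/setIP=> Gr fr; rewrite -scalemxAl -repr_mxM //= sgpM scalerA mulrC -mulrA.
by rewrite sgpK mulr1.
Qed.

Lemma symm_mxMl s : s \in G -> s \in stab f -> rG s *m symm_mx = sgp e s *: symm_mx.
Proof.
move=> Gs fs; rewrite /symm_mx mulmx_sumr scaler_sumr.
rewrite [RHS](reindex_inj (mulgI s)) /=; apply: eq_big => r.
  by rewrite groupMl // inE Gs.
case/setIP=> Gr fr; rewrite -scalemxAr -repr_mxM //= sgpM scalerA mulrA.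
by rewrite sgpK mul1r.
Qed.

Lemma symm_mx_inv m (v : 'M_(m, d)) : semi_inv (v *m symm_mx).
Proof.
by move=> s Gs fs; rewrite -mulmxA symm_mxM // -scalemxAr.
Qed.

Lemma semi_inv_symm m (v : 'M_(m, d)) : semi_inv v -> v *m symm_mx = #|G :&: stab f|%:R *: v.
Proof.
move=> vP; rewrite mulmx_sumr (eq_bigr (fun _ => v)).
  by rewrite sumr_const scaler_nat.
by move=> s /setIP[Gs fs]; rewrite -scalemxAr vP // scalerA sgpK scale1r.
Qed.

Lemma card_GIstab_neq0 : #|G :&: stab f|%:R != 0 :> rat.
Proof. by rewrite pnatr_eq0 -lt0n; apply: cardG_gt0. Qed.

Lemma has_semi_invP :
  reflect (exists2 v : 'rV_d, v != 0 & semi_inv v) has_semi_inv.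
Proof.
apply: (iffP idP) => [nz|[v nz_v /semi_inv_symm vf]]; last first.
  apply: contraNneq nz_v => f0; move/esym/eqP: vf.
  by rewrite f0 mulmx0 scaler_eq0 (negPf card_GIstab_neq0).
have [i nz_i]: exists i, row i symm_mx != 0.
  apply/existsP; apply: contraNT nz; rewrite negb_exists => /forallP z.
  by apply/eqP/row_matrixP=> i; move/negbNE/eqP: (z i) ->; rewrite row0.
by exists (row i symm_mx); rewrite // rowE; apply: symm_mx_inv.
Qed.

End OneColouring.

Lemma semi_inv_sub (C D : eqType) (f : T -> C) (g : T -> D) m (v : 'M_(m, d)) :
  (forall x y, g x = g y -> f x = f y) -> semi_inv f v -> semi_inv g v.
Proof.
move=> fg vP; move=> s Gs /stabP gs.
by apply: vP => //; apply/stabP=> x; apply: fg.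
Qed.

Lemma has_semi_inv_sub (C D : eqType) (f : T -> C) (g : T -> D) :
  (forall x y, g x = g y -> f x = f y) -> has_semi_inv f -> has_semi_inv g.
Proof.
by move=> fg /has_semi_invP[v nz /(semi_inv_sub fg) vg]; apply/has_semi_invP; exists v.
Qed.

Lemma has_semi_inv_inj (C : eqType) (f : T -> C) :
  injective f -> (0 < d)%N -> has_semi_inv f.
Proof.
move=> f_inj d_gt0; rewrite /has_semi_inv /symm_mx stab_inj // setIC.
rewrite (setIidPl (sub1G G)) big_set1 sgp1 scale1r repr_mx1.
by case: d d_gt0 rG => // d' _ _; apply: oner_neq0.
Qed.

Lemma semi_inv_comp (C : eqType) (f : T -> C) s m (v : 'M_(m, d)) :
  s \in G -> semi_inv f v -> semi_inv (f \o s) (v *m rG s^-1%g).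
Proof.
move=> Gs vP; move=> r Gr; rewrite stab_comp => fr.
rewrite -mulmxA -repr_mxM ?groupV // (_ : s^-1 * r = r ^ s * s^-1)%g.
  by rewrite repr_mxM ?groupJ ?groupV // mulmxA (vP _ (groupJ Gr Gs) fr) sgpJ scalemxAl.
by rewrite conjgE -!mulgA mulgV mulg1.
Qed.

Lemma has_semi_inv_comp (C : eqType) (f : T -> C) s :
  s \in G -> has_semi_inv f -> has_semi_inv (f \o s).
Proof.
move=> Gs /has_semi_invP[v nz /(semi_inv_comp Gs) vf].
apply/has_semi_invP; exists (v *m rG s^-1%g) => //.
by apply: contraNneq nz => v0; rewrite -(repr_mxKV rG Gs v) v0 mul0mx.
Qed.

End SemiInvariant.

Lemma has_semi_inv_rsim (T : finType) (G : {group {perm T}}) d1 d2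
    (r1 : mx_representation rat G d1) (r2 : mx_representation rat G d2) e
    (C : eqType) (f : T -> C) B :
  row_free B -> {in G, forall x, r1 x *m B = B *m r2 x} ->
  has_semi_inv r1 e f -> has_semi_inv r2 e f.
Proof.
move=> Bfree homB /has_semi_invP[v nz vP].
apply/has_semi_invP; exists (v *m B).
  by apply: contraNneq nz => vB0; apply/eqP; apply: (row_free_inj Bfree); rewrite mul0mx.
by move=> s Gs fs; rewrite -mulmxA -homB // mulmxA vP // scalemxAl.
Qed.

(** * Semi-invariants of minimal cost *)

Definition recolour (T : finType) (C : eqType) (f : T -> C) y i : T -> C :=
  fun x => if x == y then i else f x.

Section Recolour.

Variables (T : finType) (d : nat).
Variables (rG : mx_representation rat [set: {perm T}] d) (e : bool).
Variables (C : eqType) (f : T -> C) (y : T) (i : C) (v : 'rV[rat]_d).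
Hypothesis vf : semi_inv rG e f v.

Let f' := recolour f y i.
Let w := \sum_(x | f' x == i) sgp e (tperm x y) *: (v *m rG (tperm x y)).

(* The transpositions (x y), for x of colour i under f', represent the cosets in *)
(* stab f' of its subgroup fixing y, and that subgroup also preserves f.       *)
Lemma recolour_semi_inv : semi_inv rG e f' w.
Proof.
move=> s _ /stabP sP; rewrite mulmx_suml scaler_sumr.
rewrite [RHS](reindex_inj (@perm_inj _ s)) /=; apply: eq_big => x.
  by rewrite sP.
move=> /eqP fx; pose h := (tperm x y * s * tperm (s x) y)%g.
have f'y : f' y = i by rewrite /f' /recolour eqxx.
have hy : h y = y by rewrite !permM tpermR tpermL.
have hf : h \in stab f.
  apply/stabP=> z; have [->|neq_zy] := eqVneq z y; first by rewrite hy.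
  have neq_hz : h z != y by rewrite -hy (inj_eq perm_inj).
  have: f' (h z) = f' z.
    have tP u t : f' u = i -> f' (tperm u y t) = f' t.
      by move=> fu; case: tpermP => [->|->|//]; rewrite ?f'y fu.
    by rewrite !permM tP ?sP ?tP.
  by rewrite /f' /recolour (negPf neq_zy) (negPf neq_hz).
have Dts : (tperm x y * s = h * tperm (s x) y)%g.
  by rewrite /h -!mulgA tperm2 mulg1.
have sgh : sgp e (tperm x y) * sgp e s = sgp e h * sgp e (tperm (s x) y).
  by rewrite -!sgpM Dts.
rewrite -scalemxAl -mulmxA -repr_mxM ?inE // Dts repr_mxM ?inE // mulmxA.
rewrite (vf (in_setT h) hf) // -scalemxAl !scalerA; congr (_ *: _).
have -> : sgp e (tperm x y) = sgp e h * sgp e (tperm (s x) y) * sgp e s.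
  by rewrite -sgh -mulrA sgpK mulr1.
by rewrite mulrAC -mulrA mulrACA sgpK mul1r mulrC.
Qed.

(** The semi-invariant [w] must vanish. Its term at [x = y] is [v]; the others run over the points
    that had colour [i] already, each with sign [(-1) ^+ e]. *)
Lemma recolour_sum :
  i != f y -> ~~ has_semi_inv rG e f' ->
  \sum_(x | f x == i) v *m rG (tperm x y) = - (-1) ^+ e *: v.
Proof.
move=> neq_i nof'; have w0 : w = 0.
  apply: contraNeq nof' => nz; apply/has_semi_invP.
  by exists w => //; apply: recolour_semi_inv.
move: w0; rewrite /w (bigD1 y) /=; last by rewrite /f' /recolour eqxx.
rewrite tperm1 sgp1 scale1r repr_mx1 mulmx1 => /eqP; rewrite addrC addr_eq0.
rewrite (eq_big (fun x => f x == i) (fun x => (-1) ^+ e *: (v *m rG (tperm x y)))).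
- rewrite -scaler_sumr => /eqP/(congr1 (fun u => (-1) ^+ e *: u)).
  by rewrite scalerA -expr2 sqrr_sign scale1r => ->; rewrite scalerN scaleNr.
- move=> x; rewrite /f' /recolour; case: (x =P y) => [->|_]; last by rewrite andbT.
  by rewrite andbF eq_sym (negPf neq_i).
move=> x /andP[_ neq_xy].
by rewrite sgp_tperm neq_xy andbT.
Qed.

End Recolour.

Section MinimalCost.

Variables (T : finType) (N : nat).
Implicit Types f g : {ffun T -> 'I_N}.

Definition cost (f : T -> 'I_N) : nat := \sum_x N ^ f x.

Lemma cost_comp (f : T -> 'I_N) (s : {perm T}) : cost (f \o s) = cost f.
Proof. by rewrite /cost [RHS](reindex_inj (@perm_inj _ s)). Qed.

Lemma cost_recolour (f : T -> 'I_N) y (i : 'I_N) :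
  (i < f y)%N -> (cost (recolour f y i) < cost f)%N.
Proof.
move=> lt_i; rewrite /cost (bigD1 y) //= [X in (_ < X)%N](bigD1 y) //=.
rewrite /recolour eqxx (eq_bigr (fun x => N ^ f x)%N) => [|x /negPf-> //].
by rewrite ltn_add2r ltn_exp2l // (leq_ltn_trans _ (ltn_ord (f y))) // (leq_ltn_trans _ lt_i).
Qed.

Variables (d : nat) (rG : mx_representation rat [set: {perm T}] d).

Definition min_cost e f :=
  has_semi_inv rG e f /\ forall g, has_semi_inv rG e g -> (cost f <= cost g)%N.

Lemma ex_min_cost e f0 : has_semi_inv rG e f0 -> {f | min_cost e f}.
Proof.
move=> f0P; case: (@arg_minnP _ f0 (fun f : {ffun T -> 'I_N} => has_semi_inv rG e f) (fun f => cost f)) => //.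
by move=> f fP minf; exists f.
Qed.

(** Ordered pairs are summed, diagonal included: this is twice the sum of all transpositions plus
    [#|T|] times the identity. *)
Definition tperm_sum : 'M[rat]_d := \sum_y \sum_x rG (tperm x y).

Lemma tperm_sum_cent s : rG s *m tperm_sum = tperm_sum *m rG s.
Proof.
rewrite /tperm_sum mulmx_sumr mulmx_suml.
rewrite (reindex_inj (@perm_inj _ s)); apply: eq_bigr => y _.
rewrite mulmx_sumr mulmx_suml (reindex_inj (@perm_inj _ s)); apply: eq_bigr => x _.
by rewrite -!repr_mxM ?inE // -tpermJ conjgE mulKVg.
Qed.

Definition colour_pairs (C : eqType) (f : T -> C) : nat := \sum_y \sum_(x | f x == f y) 1.

(** For fixed [y] the points [x] are split by comparing [f x] with [f y]. Equal colours contribute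
    by semi-invariance. Each colour below [f y] contributes [- (-1) ^+ e *: v] by [recolour_sum],
    since recolouring [y] would lower the cost. After summing over [y], the higher colours become
    the lower ones by exchanging [x] and [y]. *)
Lemma tperm_sum_min e f (v : 'rV_d) :
  min_cost e f -> semi_inv rG e f v ->
  v *m tperm_sum =
    (#|T|%:R + (-1) ^+ e * ((colour_pairs f)%:R - #|T|%:R - 2 * (\sum_y f y)%:R)) *: v.
Proof.
move=> [fP minf] vf.
have lower y (i : 'I_N) : (i < f y)%N ->
    \sum_(x | f x == i) v *m rG (tperm x y) = - (-1) ^+ e *: v.
  move=> lt_i; apply: recolour_sum => //; first by rewrite neq_ltn lt_i.
  apply: contraL (cost_recolour lt_i) => h; rewrite -leqNgt.
  have := minf [ffun x => recolour f y i x].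
  rewrite /cost; under [X in (_ <= X)%N]eq_bigr do rewrite ffunE.
  apply; apply: has_semi_inv_sub h => a b; by rewrite !ffunE.
have low y : \sum_(x | (f x < f y)%N) v *m rG (tperm x y) = - (f y)%:R * (-1) ^+ e *: v.
  rewrite (partition_big f (fun i : 'I_N => (i < f y)%N)) //=.
  rewrite (eq_bigr (fun _ => - (-1) ^+ e *: v)) => [|i lt_i].
    rewrite sumr_const -scaler_nat scalerA mulrN mulNr; congr (- (_%:R * _) *: _).
    by rewrite -sum1_card (big_ord_narrow (ltnW (ltn_ord (f y)))) sum1_card card_ord.
  rewrite -(lower y i) //; apply: eq_bigl => x.
  by case: (f x =P i) => [->|_]; rewrite ?lt_i ?andbF.
have same y : \sum_(x | f x == f y) v *m rG (tperm x y) =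
    (1 + (-1) ^+ e * ((\sum_(x | f x == f y) 1)%:R - 1)) *: v.
  rewrite (bigD1 y) //= tperm1 repr_mx1 mulmx1 scalerDl scale1r; congr (_ + _).
  rewrite [in RHS](bigD1 y) //= natrD addrAC subrr add0r natr_sum mulr_sumr scaler_suml.
  apply: eq_bigr => x /andP[/eqP fxy neq_xy].
  by rewrite (vf _ (in_setT _) (stab_tperm fxy)) sgp_tperm neq_xy andbT mulr1.
have sumlow : \sum_y \sum_(x | (f x < f y)%N) v *m rG (tperm x y)
    = - (\sum_y f y)%:R * (-1) ^+ e *: v.
  rewrite (eq_bigr _ (fun y _ => low y)) -scaler_suml natr_sum.
  by rewrite -mulr_suml sumrN.
have sumhigh : \sum_y \sum_(x | (f y < f x)%N) v *m rG (tperm x y)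
    = - (\sum_y f y)%:R * (-1) ^+ e *: v.
  rewrite -sumlow (exchange_big_dep predT) //=; apply: eq_bigr => y _.
  by apply: eq_bigr => x _; rewrite tpermC.
have -> : v *m tperm_sum = \sum_y \sum_(x | f x == f y) v *m rG (tperm x y)
   + (\sum_y \sum_(x | (f x < f y)%N) v *m rG (tperm x y)
   + \sum_y \sum_(x | (f y < f x)%N) v *m rG (tperm x y)).
  rewrite -!big_split mulmx_sumr; apply: eq_bigr => y _; rewrite mulmx_sumr.
  rewrite (bigID (fun x => f x == f y)) /=; congr (_ + _).
  rewrite (bigID (fun x => (f x < f y)%N)) /=; congr (_ + _); apply: eq_bigl => x.
    by rewrite -val_eqE /=; case: ltngtP.
  by rewrite -val_eqE /=; case: ltngtP.
rewrite sumlow sumhigh (eq_bigr _ (fun y _ => same y)) -scaler_suml -!scalerDl.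
congr (_ *: _); rewrite big_split /= sumr_const -mulr_sumr sumrB sumr_const -natr_sum.
by rewrite /colour_pairs; ring.
Qed.

End MinimalCost.

(** * Pairs of colourings that form a Young diagram *)

Section Diagram.
Local Open Scope nat_scope.

Variable T : finType.
Implicit Types f g : T -> nat.

Definition joint_inj (C D : eqType) (f : T -> C) (g : T -> D) : Prop :=
  forall x y, f x = f y -> g x = g y -> x = y.

(** With [f] as column number and [g] as row number, this counts the points above [y] in its column;
    in a Young diagram it equals [g y]. *)
Definition below f g y : nat := #|[set x | (f x == f y) && (g x < g y)]|.

(** Since [g] is injective on each class of [f], exactly one of two distinct points of a class lies
    below the other; the diagonal accounts for [#|T|]. *)
Lemma colour_pairsE f g : joint_inj f g ->
  colour_pairs f = #|T| + 2 * \sum_y below f g y.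
Proof.
move=> fg; rewrite /colour_pairs.
have -> : \sum_y \sum_(x | f x == f y) 1 = \sum_y (1 + (below f g y +
    \sum_(x | (f x == f y) && (g y < g x)) 1)).
  apply: eq_bigr => y _; rewrite (bigD1 y) //=; congr (_ + _).
  rewrite (bigID (fun x => g x < g y)) /= /below -sum1_card; congr (_ + _).
    apply: eq_bigl => x; rewrite inE; case: (f x =P f y) => //= fxy.
    by case: eqP => [->|]; rewrite ?ltnn.
  apply: eq_bigl => x; case: (f x =P f y) => //= fxy.
  case: (x =P y) => [->|neq_xy] /=; first by rewrite ltnn.
  by rewrite -leqNgt leq_eqVlt; case: eqP => // /esym/(fg _ _ fxy).
rewrite !big_split /= sum1_card mul2n -addnn; congr (_ + (_ + _)).
rewrite (exchange_big_dep predT) //=; apply: eq_bigr => y _.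
rewrite /below -sum1_card; apply: eq_bigl => x; by rewrite inE eq_sym.
Qed.

Section Column.

Variables (f g : T -> nat) (y : T).
Hypothesis fg : joint_inj f g.

Let below_seq := [seq g x | x in [set x | (f x == f y) && (g x < g y)]].

Let below_uniq : uniq below_seq.
Proof.
rewrite map_inj_in_uniq ?enum_uniq // => x z.
rewrite !mem_enum !inE => /andP[/eqP fx _] /andP[/eqP fz _]; apply: fg.
by rewrite fx.
Qed.

Let below_sub : {subset below_seq <= iota 0 (g y)}.
Proof. by move=> _ /imageP[x + ->]; rewrite inE mem_iota => /andP[]. Qed.

Lemma below_le : below f g y <= g y.
Proof. by have := uniq_leq_size below_uniq below_sub; rewrite size_iota size_image. Qed.

Lemma below_ge : (forall j, j < g y -> exists x, f x = f y /\ g x = j) -> g y <= below f g y.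
Proof.
move=> down; rewrite -(size_iota 0 (g y)).
have := @uniq_leq_size _ (iota 0 (g y)) below_seq (iota_uniq _ _); rewrite size_image.
apply=> j; rewrite mem_iota => /= /[dup] lt_j /down[x [fx gx]].
by apply/imageP; exists x; rewrite // inE fx gx eqxx.
Qed.

(** The values of [g] below [y] are as many as the numbers less than [g y], so they exhaust them. *)
Lemma below_down : below f g y = g y -> forall j, j < g y -> exists x, f x = f y /\ g x = j.
Proof.
move=> eq_y j lt_j.
have [_ mem_b] := uniq_min_size below_uniq below_sub
  (eq_leq (etrans (size_iota _ _) (etrans (esym eq_y) (esym (size_image _ _))))).
have: j \in below_seq by rewrite mem_b mem_iota.
by case/imageP=> x; rewrite inE => /andP[/eqP fx _] ->; exists x.
Qed.

(** A point has [g x] points below it in its column, so [g x] is less than the column length; being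
    distinct, these values fill the initial interval. *)
Lemma column_values : (forall x, below f g x = g x) ->
  [seq g x | x in [set x | f x == f y]] =i iota 0 #|[set x | f x == f y]|.
Proof.
move=> eq_b; set s := image _ _.
have s_uniq : uniq s.
  rewrite map_inj_in_uniq ?enum_uniq // => x z.
  by rewrite !mem_enum !inE => /eqP fx /eqP fz; apply: fg; rewrite fx.
have s_sub : {subset s <= iota 0 #|[set x | f x == f y]|}.
  move=> _ /imageP[x + ->]; rewrite inE mem_iota /= add0n -eq_b => /eqP fx.
  apply: proper_card; apply/properP; split; last by exists x; rewrite !inE ?fx ?ltnn ?andbF.
  by apply/subsetP=> z; rewrite !inE fx => /andP[].
by have [|_] := uniq_min_size s_uniq s_sub; rewrite // size_iota size_image.
Qed.

End Column.

(* At most g y points of the colour class of y lie below y; equality for every *)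
(* point, and symmetrically, says that (g, f) maps onto a Young diagram.       *)
Lemma diagram_eq f g : joint_inj f g ->
  2 * \sum_x f x + 2 * \sum_x g x + 2 * #|T| = colour_pairs f + colour_pairs g ->
  (forall x, below f g x = g x) /\ (forall x, below g f x = f x).
Proof.
move=> fg; have gf : joint_inj g f by move=> x y gxy fxy; apply: fg.
rewrite (colour_pairsE fg) (colour_pairsE gf) => eq_s.
have leG : \sum_x below f g x <= \sum_x g x by apply: leq_sum => x _; apply: below_le.
have leF : \sum_x below g f x <= \sum_x f x by apply: leq_sum => x _; apply: below_le.
have pointwise (u v : T -> nat) : (forall x, u x <= v x) ->
    \sum_x u x = \sum_x v x -> forall x, u x = v x.
  move=> le_uv /eqP; have := leqif_sum (fun i (_ : true) => leqif_eq (le_uv i)).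
  by move=> /leqifP; case: ifP => [/forallP h _ _ x | _ /ltn_eqF->//]; apply/eqP/h.
by split; apply: pointwise => [x|]; [exact: below_le | lia | exact: below_le | lia].
Qed.

End Diagram.

(** * Polytabloids *)

Lemma sorted_geq_nth s i j : sorted geq s -> (i <= j)%N -> (nth 0 s j <= nth 0 s i)%N.
Proof.
move=> ss; rewrite leq_eqVlt => /predU1P[->//|lt_ij].
have [lt_j|/(nth_default 0%N)->//] := ltnP j (size s).
have geq_tr : transitive geq by move=> a b c /= h1 h2; apply: leq_trans h2 h1.
by apply: (sorted_ltn_nth geq_tr 0%N ss) => //; rewrite inE ?(ltn_trans lt_ij).
Qed.

Lemma fibre_perm_ex (T : finType) (C : finType) (f g : T -> C) :
  (forall c, #|[set x | f x == c]| = #|[set x | g x == c]|) ->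
  exists s : {perm T}, forall x, g (s x) = f x.
Proof.
move=> eq_fg.
pose F c := [set x | f x == c]; pose G c := [set x | g x == c].
have bnd x : (index x (enum (F (f x))) < size (enum (G (f x))))%N.
  by rewrite -cardE -eq_fg cardE index_mem mem_enum inE.
pose h x := nth x (enum (G (f x))) (index x (enum (F (f x)))).
have gh x : g (h x) = f x.
  have: h x \in enum (G (f x)) by apply: mem_nth.
  by rewrite mem_enum inE => /eqP.
have h_inj : injective h.
  move=> x y eq_h; have fxy : f x = f y by rewrite -!gh eq_h.
  move/eqP: eq_h; rewrite /h fxy (set_nth_default y x); last by have := bnd x; rewrite fxy.
  have bx := bnd x; have by' := bnd y; rewrite fxy in bx.
  rewrite nth_uniq ?enum_uniq // => /eqP/(congr1 (nth x (enum (F (f y))))).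
  by rewrite !nth_index // mem_enum inE ?fxy.
by exists (perm h_inj) => x; rewrite permE gh.
Qed.

Section Cells.

Variable lam : seq nat.
Hypothesis lam_sorted : sorted geq lam.
Let L := size lam.
Let h := head 0%N lam.

Lemma cell_width i : (nth 0 lam i <= h)%N.
Proof. by rewrite -[h]nth0; apply: sorted_geq_nth. Qed.

Lemma sum_cells (F : nat -> nat -> nat) :
  (\sum_(c : 'I_L * 'I_h | c.2 < nth 0 lam c.1) F c.1 c.2 =
   \sum_(i < L) \sum_(j < nth 0 lam i) F i j)%N.
Proof.
rewrite -(pair_big_dep xpredT (fun (i : 'I_L) (j : 'I_h) => j < nth 0 lam i)%N
  (fun i j => F i j)) /=; apply: eq_bigr => i _.
by rewrite (big_ord_narrow (cell_width i)).
Qed.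

Lemma sum_parts (F : nat -> nat) : (\sum_(i < L) F (nth 0 lam i) = \sum_(k <- lam) F k)%N.
Proof. by rewrite (big_nth 0%N) big_mkord. Qed.

End Cells.

Section Polytabloids.

Variables (T : finType) (lam : seq nat).
Hypothesis lam_sorted : sorted geq lam.

Local Notation L := (size lam).
Local Notation h := (head 0%N lam).
Local Notation M := (young_repr T lam).
Implicit Types (t : tableau T lam) (k : tabloid T lam).

Definition tab_row t x : 'I_L := (val t x).1.
Definition tab_col t x : 'I_h := (val t x).2.

Lemma tableau_inj t : joint_inj (tab_row t) (tab_col t).
Proof.
move=> x y rxy cxy; have /andP[/injectiveP t_inj _] := valP t; apply: t_inj.
by rewrite [LHS]surjective_pairing [RHS]surjective_pairing; congr (_, _).
Qed.

Lemma tab_col_lt t x : (tab_col t x < nth 0 lam (tab_row t x))%N.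
Proof.
by have /andP[_ /forallP/(_ (val t x))/eqP <-] := valP t; apply: codom_f.
Qed.

Lemma tableau_cell t (i j : nat) :
  (j < nth 0 lam i)%N -> exists x, tab_row t x = i :> nat /\ tab_col t x = j :> nat.
Proof.
move=> lt_j; have lt_i : (i < L)%N.
  by rewrite ltnNge; apply/negP=> /(nth_default 0%N) e; rewrite e in lt_j.
have lt_h : (j < h)%N by apply: leq_trans lt_j (cell_width lam_sorted i).
have /andP[_ /forallP/(_ (Ordinal lt_i, Ordinal lt_h))/eqP] := valP t.
by rewrite /= lt_j => /codomP[x Dx]; exists x; rewrite /tab_row /tab_col -Dx.
Qed.

Lemma sum_tableau t (F : nat -> nat -> nat) :
  (\sum_x F (tab_row t x) (tab_col t x) = \sum_(i < L) \sum_(j < nth 0 lam i) F i j)%N.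
Proof.
rewrite -(sum_cells lam_sorted) /tab_row /tab_col.
have /andP[/injectiveP t_inj /forallP tP] := valP t.
rewrite -(big_imset (fun c : 'I_L * 'I_h => F c.1 c.2) (in2W t_inj)) /=.
apply: eq_bigl => c; rewrite -(eqP (tP c)).
by apply/imsetP/codomP=> [[x _ ->]|[x ->]]; exists x.
Qed.

Lemma tableau_card_row t (i : 'I_L) : #|[set x | tab_row t x == i]| = nth 0%N lam i.
Proof.
rewrite -sum1_card big_mkcond /=.
rewrite (eq_bigr (fun x => (tab_row t x == i :> nat) : nat)) => [|x _]; last first.
  by rewrite inE -val_eqE; case: ifP.
rewrite (sum_tableau t (fun a _ => (a == i :> nat) : nat)) (bigD1 i) //= eqxx.
rewrite sum1_card card_ord big1 ?addn0 // => j neq_ji.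
by rewrite big1 // => _ _; rewrite val_eqE (negPf neq_ji).
Qed.

(** Parts decrease weakly, so all cells above a cell of the diagram belong to it. *)
Lemma tableau_down_row t y : below (fun x => tab_col t x) (fun x => tab_row t x) y = tab_row t y.
Proof.
apply/eqP; rewrite eqn_leq; apply/andP; split.
  apply: (@below_le _ _ (fun x => tab_row t x) y).
  by move=> x z /ord_inj cx /ord_inj rx; apply: (tableau_inj rx cx).
apply: (@below_ge _ _ (fun x => tab_row t x) y) => j lt_j.
have := tab_col_lt t y.
move/leq_trans/(_ (sorted_geq_nth lam_sorted (ltnW lt_j))).
by case/(tableau_cell t)=> x [rx cx]; exists x.
Qed.

Lemma row_map_tabloid t : is_tabloid (row_map (val t)).
Proof.
apply/forallP=> i; rewrite -(tableau_card_row t i); apply/eqP/eq_card=> x.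
by rewrite !inE ffunE.
Qed.

Definition tab_of t : tabloid T lam := Sub (row_map (val t)) (row_map_tabloid t).

Definition tdelta k : 'rV[rat]_#|{: tabloid T lam}| := delta_mx 0 (enum_rank k).

Definition trelabel k s : tabloid T lam :=
  Sub (relabel (val k) s) (relabel_is_tabloid s (valP k)).

Lemma tdelta_act k s : tdelta k *m M s = tdelta (trelabel k s).
Proof.
rewrite -rowE; apply/rowP=> j; rewrite !mxE eqxx enum_rankK /=.
rewrite -(inj_eq enum_val_inj) enum_rankK -val_eqE /=; congr (_%:R).
by rewrite eq_sym.
Qed.

Lemma tabloid_row_sum (v : 'rV[rat]_#|{: tabloid T lam}|) :
  v = \sum_k v 0 (enum_rank k) *: tdelta k.
Proof.
rewrite {1}[v]row_sum_delta (reindex_onto enum_rank enum_val) => [|i _]; last exact: enum_valK.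
by apply: eq_bigl => k; rewrite enum_rankK eqxx.
Qed.

Lemma col_stabE t : col_stab (val t) = stab (tab_col t).
Proof. by []. Qed.

Lemma polytabloidE t :
  polytabloid t = tdelta (tab_of t) *m symm_mx M true (tab_col t).
Proof.
rewrite /symm_mx setTI mulmx_sumr; apply/rowP=> j; rewrite mxE summxE.
apply: eq_big => s; first by rewrite -col_stabE.
move=> _; rewrite -scalemxAr tdelta_act !mxE eqxx /=; congr (_ * _%:R).
by rewrite -(inj_eq enum_val_inj) enum_rankK -val_eqE /= eq_sym.
Qed.

(** Only the identity preserves both the rows and the columns of [t], so no other term of the sum
    meets the tabloid of [t]. *)
Lemma polytabloid_diag t : polytabloid t 0 (enum_rank (tab_of t)) = 1.
Proof.
rewrite mxE (bigD1 1%g) /=; last by rewrite col_stabE group1.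
rewrite enum_rankK relabel1 eqxx odd_perm1 mulr1 big1 ?addr0 // => s /andP[+ neq_s].
rewrite col_stabE => /stabP sP; case: eqP => [eq_r|]; last by rewrite mulr0.
case/eqP: neq_s; apply/permP=> x; rewrite perm1; apply: (tableau_inj (t := t)) => //.
by move/ffunP/(_ (s x)): eq_r; rewrite !ffunE permK.
Qed.

Lemma polytabloid_neq0 t : polytabloid t != 0.
Proof.
apply/eqP=> /rowP/(_ (enum_rank (tab_of t))); rewrite polytabloid_diag mxE.
exact/eqP/oner_neq0.
Qed.

Lemma polytabloid_semi_inv t : semi_inv M true (tab_col t) (polytabloid t).
Proof. by rewrite polytabloidE; apply: symm_mx_inv. Qed.

Lemma polytabloid_conj t t' : exists s, polytabloid t' = polytabloid t *m M s.
Proof.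
have /andP[/injectiveP t_inj /forallP tP] := valP t.
have /andP[/injectiveP t'_inj /forallP t'P] := valP t'.
have ex x : val t x \in codom (val t').
  by rewrite (eqP (t'P _)) -(eqP (tP _)) codom_f.
pose s x := iinv (ex x).
have sE x : val t' (s x) = val t x by apply: f_iinv.
have s_inj : injective s by move=> x y eq_s; apply: t_inj; rewrite -!sE eq_s.
exists (perm s_inj); rewrite polytabloid_young; congr polytabloid; apply: val_inj.
apply/ffunP=> x; rewrite ffunE /= -sE; congr (val t' _).
by rewrite -[X in _ = X](permE s_inj) permKV.
Qed.

Lemma specht_spaceP t : (polytabloid t <= specht_space T lam)%MS.
Proof.
rewrite genmxE; set A := (X in (_ <= X)%MS).
have <- : row (enum_rank t) A = polytabloid t by rewrite rowK enum_rankK.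
exact: row_sub.
Qed.

Lemma specht_space_sub t (W : 'M_#|{: tabloid T lam}|) :
  mxmodule M W -> (polytabloid t <= W)%MS -> (specht_space T lam <= W)%MS.
Proof.
move=> modW tW; rewrite genmxE; apply/row_subP=> i; rewrite rowK.
have [s ->] := polytabloid_conj t (enum_val i).
by apply: submx_trans (submxMr _ tW) _; apply: (mxmoduleP modW); rewrite inE.
Qed.

(** If two points share a column of [t] and a row of [k], their transposition fixes [k] but negates
    the antisymmetrizer, which gives zero. Otherwise a column permutation of [t] carries its tabloid
    to [k], and the result is the polytabloid up to sign. *)
Lemma tdelta_symm t k : exists c, tdelta k *m symm_mx M true (tab_col t) = c *: polytabloid t.
Proof.
case: (boolP [forall x, forall y, (tab_col t x == tab_col t y) ==> (val k x == val k y) ==> (x == y)]).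
  move=> /forallP kP.
  have tk : joint_inj (fun x => tab_col t x : nat) (fun x => val k x : nat).
    move=> x y /ord_inj cxy /ord_inj kxy; have /forallP/(_ y) := kP x.
    by rewrite cxy kxy !eqxx => /eqP.
  have tt : joint_inj (fun x => tab_col t x : nat) (fun x => tab_row t x : nat).
    by move=> x z /ord_inj cx /ord_inj rx; apply: (tableau_inj rx cx).
  have fib c : #|[set x | val k x == c]| = #|[set x | tab_row t x == c]|.
    by rewrite (tableau_card_row t c); have /forallP/(_ c)/eqP := valP k.
  have eq_sum : (\sum_x val k x = \sum_x tab_row t x)%N.
    have [s sP] := fibre_perm_ex fib.
    rewrite [RHS](reindex_inj (@perm_inj _ s)) /=.
    by apply: eq_bigr => x _; rewrite -sP.
  (* The totals of row numbers for [k] and [t] agree, and for [t] the total is the least that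
     [below_le] allows; hence equality holds at each point for [k]. *)
  have kb x : below (fun x => tab_col t x) (fun x => val k x) x = val k x.
    have := colour_pairsE tk; rewrite (colour_pairsE tt) => /addnI/eqP.
    rewrite eqn_mul2l /= (eq_bigr _ (fun y _ => tableau_down_row t y)) -eq_sum eq_sym.
    have := leqif_sum (fun y (_ : true) => leqif_eq (below_le y tk)).
    by case=> _ -> /forallP/(_ x)/eqP.
  (* Within a column of [t], the row numbers under [k] and under [t] fill the same initial interval;
     matching them defines the column permutation. *)
  have ex x : exists y, (tab_col t y == tab_col t x) && (val k y == tab_row t x).
    have := column_values x tk kb (tab_row t x).
    rewrite -(column_values x tt (tableau_down_row t)).
    have -> : (tab_row t x : nat) \in [seq (tab_row t z : nat) | z in [set z | tab_col t z == tab_col t x :> nat]].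
      by apply/imageP; exists x; rewrite ?inE.
    by case/imageP=> y; rewrite inE => cy ky; exists y; rewrite -!(inj_eq val_inj) /= (eqP cy) ky !eqxx.
  pose s x := xchoose (ex x).
  have sP x : tab_col t (s x) = tab_col t x /\ val k (s x) = tab_row t x.
    by have /andP[/eqP ? /eqP ?] := xchooseP (ex x).
  have s_inj : injective s.
    move=> x y eq_s; apply: (tableau_inj (t := t)).
      by rewrite -(sP x).2 -(sP y).2 eq_s.
    by rewrite -(sP x).1 -(sP y).1 eq_s.
  pose r := perm s_inj.
  have Dk : tdelta k = tdelta (tab_of t) *m M r.
    rewrite tdelta_act; congr tdelta; apply: val_inj; apply/ffunP=> x.
    rewrite ffunE -[in LHS](permKV r x) permE (sP _).2; by rewrite ffunE.
  have rs : r \in stab (tab_col t) by apply/stabP=> x; rewrite permE (sP x).1.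
  exists (sgp true r); rewrite Dk polytabloidE -mulmxA scalemxAr; congr (_ *m _).
  exact: symm_mxMl.
case/forallPn=> x /forallPn[y]; rewrite !negb_imply => /and3P[/eqP cxy /eqP kxy neq_xy].
exists 0; rewrite scale0r; set S := symm_mx _ _ _.
have Sxy : M (tperm x y) *m S = - S.
  rewrite (@symm_mxMl _ _ _ M true _ _ _ (in_setT _) (stab_tperm cxy)).
  by rewrite sgp_tperm neq_xy scaleN1r.
have kE : tdelta k *m M (tperm x y) = tdelta k.
  rewrite tdelta_act; congr tdelta; apply: val_inj; apply/ffunP=> z.
  by rewrite ffunE /= tpermV; case: tpermP => [->|->|].
have : tdelta k *m S = - (tdelta k *m S).
  by rewrite -{1}kE -mulmxA Sxy mulmxN.
move/eqP; rewrite -subr_eq0 opprK -mulr2n -scaler_nat scaler_eq0 pnatr_eq0 /=.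
by move/eqP.
Qed.

Lemma young_symm t v : exists c, v *m symm_mx M true (tab_col t) = c *: polytabloid t.
Proof.
rewrite [v]tabloid_row_sum mulmx_suml.
elim/big_rec: _ => [|k w _ [c ->]]; first by exists 0; rewrite scale0r.
have [a Da] := tdelta_symm t k; rewrite -scalemxAl Da scalerA -scalerDl.
by eexists.
Qed.

End Polytabloids.

Lemma has_semi_inv_submod (T : finType) (G : {group {perm T}}) d
    (rG : mx_representation rat G d) (U : 'M_d) (modU : mxmodule rG U) e
    (C : eqType) (f : T -> C) :
  reflect (exists2 v : 'rV_d, v != 0 & (v <= U)%MS /\ semi_inv rG e f v)
    (has_semi_inv (submod_repr modU) e f).
Proof.
apply: (iffP (has_semi_invP _ _ _)) => [[v nz vf]|[v nz [vU vf]]].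
  exists (val_submod v); first by rewrite val_submod_eq0.
  split=> [|s Gs fs]; first exact: val_submodP.
  by rewrite -(val_submodJ modU) // vf // linearZ.
exists (in_submod U v) => [|s Gs fs].
  by rewrite -val_submod_eq0 in_submodK.
by apply: val_submod_inj; rewrite val_submodJ // linearZ /= !in_submodK // vf.
Qed.

Lemma rat_Maschke (gT : finGroupType) (G : {group gT}) d
  (rG : mx_representation rat G d) : mx_completely_reducible rG 1%:M.
Proof.
by apply: mx_Maschke_pchar; rewrite /pgroup.pgroup pcharf'_nat pnatr_eq0 -lt0n cardG_gt0.
Qed.

Definition part_cost (N : nat) (s : seq nat) : nat := \sum_(k <- s) \sum_(j < k) N ^ j.

Lemma specht_rank_gt0 (T : finType) (lam : seq nat) (t : tableau T lam) :
  sorted geq lam -> (0 < \rank (specht_space T lam))%N.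
Proof.
move=> ls; rewrite lt0n mxrank_eq0; apply: contraTneq (specht_spaceP t) => ->.
by rewrite submx0 polytabloid_neq0.
Qed.

Lemma is_partition_sorted n s : is_partition n s -> sorted geq s.
Proof. by case/and3P. Qed.

Lemma tableau_ex (T : finType) (lam : seq nat) :
  is_partition #|T| lam -> exists t : tableau T lam, True.
Proof.
case/and3P=> ls _ /eqP sum_lam.
pose A := [set c : 'I_(size lam) * 'I_(head 0%N lam) | (c.2 < nth 0 lam c.1)%N].
have cardA : #|T| = #|A|.
  rewrite -sum1_card (eq_bigl (fun c : 'I_(size lam) * 'I_(head 0%N lam) => c.2 < nth 0 lam c.1)%N) => [|c]; last by rewrite inE.
  rewrite (sum_cells ls (fun _ _ => 1%N)).
  under eq_bigr do rewrite sum1_card card_ord.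
  by rewrite (sum_parts lam id) -sumnE sum_lam.
pose t := [ffun x : T => enum_val (cast_ord cardA (enum_rank x))].
suff tP : is_tableau t by exists (Sub t tP).
apply/andP; split; first by apply/injectiveP=> x y; rewrite !ffunE => /enum_val_inj/cast_ord_inj/enum_rank_inj.
apply/forallP=> c; apply/eqP; transitivity (c \in A); last by rewrite inE.
apply/codomP/idP=> [[x ->]|Ac]; first by rewrite ffunE enum_valP.
exists (enum_val (cast_ord (esym cardA) (enum_rank_in Ac c))).
by rewrite ffunE enum_valK cast_ordKV enum_rankK_in.
Qed.

Lemma tableau_cost (T : finType) (lam : seq nat) (t : tableau T lam) N :
  sorted geq lam -> (\sum_x N ^ tab_col t x)%N = part_cost N lam.
Proof.
move=> ls; rewrite (sum_tableau ls t (fun _ j => N ^ j)%N).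
exact: (sum_parts lam (fun k => \sum_(j < k) N ^ j)%N).
Qed.

Lemma tableau_width (T : finType) (lam : seq nat) (t : tableau T lam) :
  sorted geq lam -> (head 0%N lam <= #|T|)%N.
Proof.
case: lam t => [|a l] t ls //; have := tableau_card_row ls t ord0.
by move=> /= <-; apply: max_card.
Qed.

Lemma occurs_cost (T : finType) (V : representation rat [set: {perm T}]) lam N :
  (#|T| <= N)%N -> occurs V lam ->
  exists2 f : {ffun T -> 'I_N}, has_semi_inv V true f & cost f = part_cost N lam.
Proof.
move=> leTN [lamP [W /mx_rsim_sym[B _ Bfree homB]]].
have ls := is_partition_sorted lamP; have [t _] := tableau_ex lamP.
have leN := leq_trans (tableau_width t ls) leTN.
exists [ffun x => widen_ord leN (tab_col t x)]; last first.
  by rewrite -(tableau_cost t N ls); apply: eq_bigr => x _; rewrite ffunE.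
apply: (has_semi_inv_rsim Bfree homB).
(* The matrix is the inclusion of the first summand into the direct sum. *)
apply: (@has_semi_inv_rsim _ _ _ _ (specht T lam) _ _ _ _ (row_mx 1%:M 0)).
- by apply/row_freeP; exists (col_mx 1%:M 0); rewrite mul_row_col mulmx1 mul0mx addr0.
- by move=> s _; rewrite mul_row_block mul_mx_row !mul1mx !mulmx0 mulmx1 mul0mx !addr0.
apply/has_semi_inv_submod; exists (polytabloid t); first exact: polytabloid_neq0.
split; first exact: specht_spaceP.
apply: semi_inv_sub (@polytabloid_semi_inv _ _ ls t) => x y.
by rewrite !ffunE => /(congr1 val) /= /ord_inj.
Qed.

(** * Constituents of minimal cost *)

Section DiagramTableau.

Variables (T : finType) (f g : T -> nat).
Hypotheses (fg : joint_inj f g).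
Hypotheses (downg : forall x, below f g x = g x) (downf : forall x, below g f x = f x).

Let gf : joint_inj g f. Proof. by move=> x y gxy fxy; apply: fg. Qed.
(** [g] numbers rows and [f] columns, so [r i] is the length of row [i]. *)
Let r i := #|[set x | g x == i]|.
Let L := \max_x (g x).+1.
Let lam := mkseq r L.

Let lt_L x : (g x < L)%N. Proof. exact: leq_bigmax. Qed.

Let nth_lam i : nth 0%N lam i = r i.
Proof.
have [lt_i|le_i] := ltnP i L; first by rewrite nth_mkseq.
rewrite nth_default ?size_mkseq // /r; apply/esym/eqP; rewrite cards_eq0.
apply/eqP/setP=> x; rewrite !inE; apply/eqP=> gx.
by have := lt_L x; rewrite gx ltnNge le_i.
Qed.

Let row_ex x i : (i <= g x)%N -> exists2 y, f y = f x & g y = i.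
Proof.
rewrite leq_eqVlt => /predU1P[->|lt_i]; first by exists x.
by have [y [fy gy]] := below_down fg (downg x) lt_i; exists y.
Qed.

Let row_values y j :
  (j < r (g y))%N -> exists2 x, g x = g y & f x = j.
Proof.
move=> lt_j; have := column_values y gf downf j.
rewrite mem_iota add0n /= lt_j => /imageP[x]; rewrite inE => /eqP gx ->.
by exists x.
Qed.

Let col_lt x : (f x < r (g x))%N.
Proof.
have := column_values x gf downf (f x); rewrite mem_iota add0n /= => <-.
by apply/imageP; exists x; rewrite // inE.
Qed.

(** Each point of row [j] has a point of row [i] in its column, so the distinct column numbers in
    row [j] are all less than [r i]. *)
Let r_mono i j : (i <= j)%N -> (r j <= r i)%N.
Proof.
move=> le_ij; case: (posnP (r j)) => [->//|/card_gt0P[y]]; rewrite inE => /eqP gy.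
have le_f x : g x = j -> (f x < r i)%N.
  move=> gx; have [|z fz gz] := @row_ex x i; first by rewrite gx.
  by rewrite -fz -gz; apply: col_lt.
have u : uniq [seq f x | x in [set x | g x == j]].
  rewrite map_inj_in_uniq ?enum_uniq // => x z.
  by rewrite !mem_enum !inE => /eqP gx /eqP gz; apply: gf; rewrite gx.
have sub : {subset [seq f x | x in [set x | g x == j]] <= iota 0 (r i)}.
  by move=> _ /imageP[x + ->]; rewrite inE mem_iota => /eqP/le_f.
by have := uniq_leq_size u sub; rewrite size_iota size_image.
Qed.

Lemma diagram_partition : is_partition #|T| lam.
Proof.
apply/and3P; split.
- apply/(sortedP 0%N) => i; rewrite size_mkseq => lt_i /=.
  by rewrite !nth_lam r_mono.
(* Every row number up to the largest attained one is attained, so no row before [L] is empty. *)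
- apply/negP=> /mapP[i]; rewrite mem_iota add0n /= => lt_i /esym/cards0_eq ri0.
  have : (0 < L)%N by apply: leq_ltn_trans lt_i.
  rewrite /L; case: (pickP T) => [x0 _|T0]; last by rewrite big_pred0.
  rewrite (bigmax_eq_arg x0) //; case: arg_maxnP => // x _ maxx _.
  have [|y _ gy] := @row_ex x i.
    by rewrite -ltnS (leq_trans lt_i) //; apply/bigmax_leqP=> y _; apply: maxx.
  by move/setP/(_ y): ri0; rewrite !inE gy eqxx.
rewrite sumnE big_map -[X in iota 0 X]subn0 big_mkord.
rewrite -sum1_card (partition_big (fun x => Ordinal (lt_L x)) xpredT) //=.
apply/eqP/eq_bigr => i _; rewrite /r -sum1_card; apply: eq_bigl => x.
by rewrite inE -val_eqE.
Qed.

Lemma diagram_tableau :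
  {t : tableau T lam | (forall x, tab_row t x = g x :> nat) & (forall x, tab_col t x = f x :> nat)}.
Proof.
have ltr x : (g x < size lam)%N by rewrite size_mkseq.
have ltc x : (f x < head 0 lam)%N.
  by rewrite -nth0 nth_lam; apply: leq_trans (col_lt x) (r_mono (leq0n _)).
pose t := [ffun x => (Ordinal (ltr x), Ordinal (ltc x))].
suff tP : is_tableau t by exists (Sub t tP) => x; rewrite /tab_row /tab_col /= ffunE.
apply/andP; split.
  by apply/injectiveP=> x y; rewrite !ffunE => -[gxy fxy]; apply: fg.
apply/forallP=> -[i j] /=; rewrite nth_lam; apply/eqP; apply/codomP/idP=> [[x]|lt_j].
  by rewrite ffunE => -[-> ->]; apply: col_lt.
have /card_gt0P[y] := leq_ltn_trans (leq0n _) lt_j; rewrite inE => /eqP gy.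
have [|x gx fx] := @row_values y j; first by rewrite gy.
by exists x; rewrite ffunE; congr (_, _); apply: val_inj; rewrite /= ?gx ?fx.
Qed.

End DiagramTableau.

(** * Embedding a Specht module by means of a row-invariant vector *)

Section SpechtHom.

Variables (T : finType) (lam : seq nat) (d : nat).
Variables (rG : mx_representation rat [set: {perm T}] d).
Hypothesis lam_sorted : sorted geq lam.
Local Notation M := (young_repr T lam).
Variables (t : tableau T lam) (u : 'rV[rat]_d).
Hypothesis u_row : semi_inv rG false (tab_row t) u.
Hypothesis u_col : u *m symm_mx rG true (tab_col t) != 0.

(** Frobenius reciprocity for the tabloid module, which is induced from the row stabiliser. Summing
    over all [s] that carry the tabloid of [t] to the given one avoids choosing a coset
    representative, at the cost of a factor equal to the order of the row stabiliser. *)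
Definition young_hom : 'M[rat]_(#|{: tabloid T lam}|, d) :=
  \matrix_i \sum_(s | relabel (row_map (val t)) s == val (enum_val i)) u *m rG s.

Lemma tdelta_hom k :
  tdelta k *m young_hom = \sum_(s | relabel (row_map (val t)) s == val k) u *m rG s.
Proof. by rewrite -rowE rowK enum_rankK. Qed.

Lemma young_homP s : M s *m young_hom = young_hom *m rG s.
Proof.
apply/row_matrixP=> i; rewrite !row_mul !rowE -[i]enum_valK -/(tdelta _).
rewrite tdelta_act !tdelta_hom mulmx_suml (reindex_inj (mulIg s)) /=.
have relK (k : {ffun T -> 'I_(size lam)}) : relabel (relabel k s) s^-1 = k.
  by rewrite -relabelM mulgV relabel1.
apply: eq_big => r.
  by rewrite relabelM; apply/eqP/eqP=> [eq_r|-> //]; rewrite -[LHS]relK eq_r relK.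
by move=> _; rewrite repr_mxM ?inE // mulmxA.
Qed.

(** The homomorphism commutes with the antisymmetrizer, so the image is a positive multiple of
    [u *m symm_mx rG true (tab_col t)]. *)
Lemma polytabloid_hom : polytabloid t *m young_hom != 0.
Proof.
rewrite (polytabloidE lam_sorted) -mulmxA.
have -> : symm_mx M true (tab_col t) *m young_hom = young_hom *m symm_mx rG true (tab_col t).
  rewrite /symm_mx mulmx_sumr mulmx_suml; apply: eq_bigr => s _.
  by rewrite -scalemxAl -scalemxAr young_homP.
rewrite mulmxA tdelta_hom (eq_bigl [in stab (tab_row t)]) => [|s].
  rewrite (eq_bigr (fun _ => u)) => [|s st].
    rewrite sumr_const -scaler_nat -scalemxAl scaler_eq0 negb_or u_col andbT.
    by rewrite pnatr_eq0 -lt0n cardG_gt0.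
  by rewrite u_row ?in_setT // /sgp expr0 scale1r.
rewrite inE; apply/eqP/forallP=> [/ffunP eq_s x|sP].
  by have := eq_s (s x); rewrite !ffunE permK /tab_row => ->.
by apply/ffunP=> x; rewrite !ffunE; have := eqP (sP (s^-1%g x)); rewrite permKV /tab_row => ->.
Qed.

Local Notation S := (specht_space T lam).

(* Split M^lam = K + W.  Applying the signed column sum to the decomposition of *)
(* e_t sends the K-component to a multiple of e_t lying in K, hence to 0; so W   *)
(* contains e_t, and therefore S^lam.                                           *)
Lemma specht_hom_inj : (S :&: kermx young_hom = 0)%MS.
Proof.
pose K := (S :&: kermx young_hom)%MS.
have modK : mxmodule M K.
  apply: capmx_module; first exact: specht_module.
  apply/mxmoduleP=> s _; apply/sub_kermxP.
  by rewrite -mulmxA young_homP mulmxA mulmx_ker mul0mx.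
have [W modW defKW dxKW] := rat_Maschke modK (submx1 _).
have [[a b] /= Dt] : exists ab : 'rV_ _ * 'rV_ _,
    polytabloid t = ab.1 *m K + ab.2 *m W.
  have : (polytabloid t <= K + W)%MS by rewrite defKW submx1.
  by case/sub_addsmxP=> ab ->; exists ab.
set b_t := symm_mx M true (tab_col t).
have stableS m (A : 'M_(m, _)) (U : 'M_#|{: tabloid T lam}|) :
    mxmodule M U -> (A <= U)%MS -> (A *m b_t <= U)%MS.
  move=> modU AU; rewrite mulmx_sumr summx_sub // => s _.
  rewrite -scalemxAr scalemx_sub //.
  by apply: submx_trans (submxMr _ AU) _; apply: (mxmoduleP modU); rewrite inE.
have KbK : (a *m K *m b_t <= K)%MS by rewrite stableS // submxMl.
have WbW : (b *m W *m b_t <= W)%MS by rewrite stableS // submxMl.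
have [c Dc] := young_symm lam_sorted t (a *m K).
have tK : ~~ (polytabloid t <= K)%MS.
  apply: contra polytabloid_hom; rewrite sub_capmx => /andP[_ /sub_kermxP->] //.
have c0 : c = 0.
  apply/eqP; apply: contraNT tK => nz_c.
  by rewrite -[polytabloid t]scale1r -(mulVf nz_c) -scalerA scalemx_sub // -Dc.
have tW : (polytabloid t <= W)%MS.
  have := semi_inv_symm (@polytabloid_semi_inv _ _ lam_sorted t).
  rewrite {1}Dt mulmxDl [X in X + _]Dc c0 scale0r add0r => Db.
  rewrite -[polytabloid t]scale1r -(mulVf (@card_GIstab_neq0 T [set: {perm T}]%G _ (tab_col t))) -scalerA.
  by rewrite scalemx_sub // -Db.
apply/eqP; rewrite -submx0 -(mxdirect_addsP dxKW) sub_capmx submx_refl /=.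
apply: submx_trans (capmxSl _ _) _; exact: specht_space_sub tW.
Qed.

(** The Specht module is isomorphic to its image under [young_hom], and the image has a complement
    by Maschke. *)
Lemma specht_hom_summand : is_summand (specht T lam) (Representation rG).
Proof.
pose I := <<S *m young_hom>>%MS.
have modI : mxmodule rG I.
  apply/mxmoduleP=> s Gs; rewrite (eqmxMr _ (genmxE _)) genmxE.
  by rewrite -mulmxA -young_homP mulmxA submxMr // (mxmoduleP (specht_module T lam)).
have rankI : \rank S = \rank I.
  by rewrite -(mxrank_mul_ker S young_hom) specht_hom_inj mxrank0 addn0 /I genmxE.
have [W modW defIW dxIW] := rat_Maschke modI (submx1 _).
exists (Representation (submod_repr modW)).
apply: mx_rsim_trans (mx_rsim_sym (rsim_submod1 (mxmodule1 rG) (eqmx_refl _))) _.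
apply: (mx_rsim_dadd (modU := modI) (mxmodule1 rG) defIW dxIW); last exact: (mx_rsim_refl (submod_repr modW)).
apply: mx_rsim_sym.
pose v1 := val_submod (1%:M : 'M_(\rank S)).
have v1I : (v1 *m young_hom <= I)%MS by rewrite genmxE submxMr ?val_submodP.
exists (in_submod I (v1 *m young_hom)) => // [|s Gs] /=.
  rewrite /row_free mxrank_in_submod // (eqmxMr _ (val_submod1 S)).
  by rewrite rankI genmxE.
rewrite -in_submodJ // -mulmxA -young_homP [in LHS]in_submodE [LHS]mulmxA -in_submodE.
congr in_submod; rewrite [LHS]mulmxA [RHS]mulmxA; congr (_ *m _).
rewrite /v1 -val_submodE -[submod_mx _ s]mul1mx.
by rewrite [val_submod _](val_submodJ (specht_module T lam)).
Qed.

End SpechtHom.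

Section MinimalConstituent.

Variables (T : finType) (N d : nat).
Variables (rG : mx_representation rat [set: {perm T}] d).
Hypothesis leTN : (#|T| <= N)%N.

Lemma submod_tperm_sum (U : 'M_d) (modU : mxmodule rG U) m (w : 'M_(m, \rank U)) :
  val_submod (w *m tperm_sum (submod_repr modU)) = val_submod w *m tperm_sum rG.
Proof.
rewrite /tperm_sum !mulmx_sumr linear_sum; apply: eq_bigr => y _.
rewrite !mulmx_sumr linear_sum; apply: eq_bigr => x _.
by apply: (val_submodJ modU); rewrite inE.
Qed.

(* v is a sign vector for f, and u a row-invariant vector of least cost for the *)
(* colouring g in the module generated by v.                                     *)
Lemma min_cost_occurs (f : {ffun T -> 'I_N}) : min_cost rG true f ->
  exists2 lam, occurs (Representation rG) lam & part_cost N lam = cost f.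
Proof.
move=> minf; have [fP _] := minf; have /has_semi_invP[v nz_v vf] := fP.
pose U := cyclic_mx rG v; have modU : mxmodule rG U := cyclic_mx_module rG v.
have [g ming] : exists g : {ffun T -> 'I_N}, min_cost (submod_repr modU) false g.
  have inj0 : injective [ffun x : T => widen_ord leTN (enum_rank x)].
    by move=> x y; rewrite !ffunE => /(congr1 val) /= /ord_inj/enum_rank_inj.
  have rU : (0 < \rank U)%N by rewrite lt0n mxrank_eq0 cyclic_mx_eq0.
  by have [g] := ex_min_cost (has_semi_inv_inj (submod_repr modU) false inj0 rU); exists g.
have [gP _] := ming; have /has_semi_invP[u' nz_u' u'g] := gP.
have zU := tperm_sum_min ming u'g; have zv := tperm_sum_min minf vf.
set cg := (X in X *: u') in zU; set cf := (X in X *: v) in zv.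
pose u := val_submod u'.
have uU : (u <= U)%MS by apply: val_submodP.
have nz_u : u != 0 by rewrite val_submod_eq0.
have ug : semi_inv rG false g u.
  by move=> s Gs gs; rewrite -(val_submodJ modU) // u'g // linearZ.
(* The central element acts on [v], hence on the whole module generated by [v], as the scalar
   [cf]. *)
have ker_c : (u <= kermx (tperm_sum rG - cf%:M))%MS.
  apply: submx_trans uU _; apply: cyclic_mx_sub.
    apply: kermx_centg_module; apply/centgmxP=> s _.
    by rewrite mulmxBr mulmxBl tperm_sum_cent scalar_mxC.
  by apply/sub_kermxP; rewrite mulmxBr zv mul_mx_scalar subrr.
have eq_c : cf = cg.
  have := congr1 val_submod zU; rewrite submod_tperm_sum linearZ /= -/u.
  move/sub_kermxP: ker_c; rewrite mulmxBr mul_mx_scalar => /eqP; rewrite subr_eq0 => /eqP->.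
  move/eqP; rewrite -subr_eq0 -scalerBl scaler_eq0 (negPf nz_u) orbF subr_eq0.
  by move/eqP.
(* Were every translate of [u] killed, the antisymmetrizer would put [v] into a complement [W] of
   the module [Z] generated by [u]; then [u], which lies in the module generated by [v], would lie
   in both [Z] and [W]. *)
have [s us] : exists s, u *m rG s *m symm_mx rG true f != 0.
  apply/existsP; apply: contraNT nz_u; rewrite negb_exists => /forallP us.
  pose Z := cyclic_mx rG u; have modZ : mxmodule rG Z := cyclic_mx_module rG u.
  have Zf : Z *m symm_mx rG true f = 0.
    apply/sub_kermxP; rewrite genmxE; apply/row_subP=> i.
    rewrite row_mul rowK mul_rV_lin1 /= mxvecK; apply/sub_kermxP.
    by apply/eqP/negbNE/us.
  have [W modW defZW dxZW] := rat_Maschke modZ (submx1 _).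
  have [[a b] /= Dv] : exists ab : 'rV_ _ * 'rV_ _, v = ab.1 *m Z + ab.2 *m W.
    have : (v <= Z + W)%MS by rewrite defZW submx1.
    by case/sub_addsmxP=> ab ->; exists ab.
  have vW : (v <= W)%MS.
    have := semi_inv_symm vf; rewrite {1}Dv mulmxDl -mulmxA Zf mulmx0 add0r => Db.
    rewrite -[v]scale1r -(mulVf (@card_GIstab_neq0 T [set: {perm T}]%G _ f)) -scalerA.
    rewrite scalemx_sub // -Db mulmx_sumr summx_sub // => r _.
    rewrite -scalemxAr scalemx_sub //.
    by apply: submx_trans (submxMr _ (submxMl _ _)) _; apply: (mxmoduleP modW); rewrite inE.
  have uW : (u <= W)%MS by apply: submx_trans uU _; apply: cyclic_mx_sub.
  by rewrite -submx0 -(mxdirect_addsP dxZW) sub_capmx uW cyclic_mx_id.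
pose w := u *m rG s; pose g' : T -> nat := fun x => g ((s^-1)%g x).
pose f' : T -> nat := fun x => f x.
have wg : semi_inv rG false g' w.
  have := semi_inv_comp (groupVr (in_setT s)) ug; rewrite invgK.
  by apply: semi_inv_sub => x y /ord_inj.
(* Two points with equal colours under both [f'] and [g'] give a transposition that fixes [w] and
   negates the antisymmetrizer, which would then kill [w]. *)
have fg : joint_inj f' g'.
  move=> x y fxy gxy; apply/eqP; apply: contraNT us => neq_xy.
  have wE : w *m rG (tperm x y) = w.
    by rewrite (wg _ (in_setT _) (stab_tperm gxy)) /sgp expr0 scale1r.
  have fE : rG (tperm x y) *m symm_mx rG true f = - symm_mx rG true f.
    rewrite (@symm_mxMl _ _ _ rG true _ f _ (in_setT _) (stab_tperm (ord_inj fxy))).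
    by rewrite sgp_tperm neq_xy scaleN1r.
  have : w *m symm_mx rG true f = - (w *m symm_mx rG true f).
    by rewrite -{1}wE -mulmxA fE mulmxN.
  move/eqP; rewrite -subr_eq0 opprK -mulr2n -scaler_nat scaler_eq0 pnatr_eq0 /=.
  by [].
have sumg : (\sum_x g' x = \sum_x g x)%N.
  by rewrite [RHS](reindex_inj (@perm_inj _ (s^-1)%g)).
have pairsg : colour_pairs g' = colour_pairs g.
  rewrite /colour_pairs [RHS](reindex_inj (@perm_inj _ (s^-1)%g)) /=; apply: eq_bigr => y _.
  by rewrite [RHS](reindex_inj (@perm_inj _ (s^-1)%g)).
have pairsf : colour_pairs f' = colour_pairs f by [].
(* The scalar is $2|T| - p_f + 2\sum f$ for the sign vector and $p_g - 2\sum g$ for the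
   row-invariant one, where $p$ stands for [colour_pairs]. *)
have eq_sum : (2 * \sum_x f' x + 2 * \sum_x g' x + 2 * #|T| = colour_pairs f' + colour_pairs g')%N.
  rewrite sumg pairsg pairsf; apply/eqP; rewrite -(eqr_nat rat); apply/eqP.
  rewrite !natrD; move: eq_c; rewrite /cf /cg /f' expr1 expr0 => eq_c.
  apply/eqP; rewrite -subr_eq0; move/eqP: eq_c; rewrite -subr_eq0 => /eqP eq_c.
  by apply/eqP; rewrite -[RHS]eq_c; ring.
have [downg downf] := diagram_eq fg eq_sum.
have lamP := diagram_partition fg downg downf.
have [t tg tf] := diagram_tableau fg downg downf.
set lam := mkseq _ _ in lamP t tg tf.
have ls := is_partition_sorted lamP.
exists lam; last by rewrite -(tableau_cost t N ls); apply: eq_bigr => x _; rewrite tf.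
split=> //; apply: (@specht_hom_summand _ _ _ _ ls t w).
  by apply: semi_inv_sub wg => x y; rewrite -!tg => ->.
suff -> : symm_mx rG true (tab_col t) = symm_mx rG true f by [].
rewrite /symm_mx (@eq_stab _ _ _ (tab_col t) f) // => x y.
by rewrite -!(inj_eq val_inj) /= !tf.
Qed.

End MinimalConstituent.

(** * The lexicographic order through costs *)

Section LexCost.
Local Open Scope nat_scope.

Variable N : nat.

Definition good_part (s : seq nat) := [&& sorted geq s, 0 \notin s & sumn s < N].

Lemma part_cost_cons k s : part_cost N (k :: s) = \sum_(j < k) N ^ j + part_cost N s.
Proof. by rewrite /part_cost big_cons. Qed.

Lemma sorted_geq_head k s : sorted geq (k :: s) -> forall j, j \in s -> j <= k.
Proof.
move=> ss j /(nthP 0)[i lt_i <-].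
by have := sorted_geq_nth ss (leq0n i.+1).
Qed.

(** Each part [j] is at most [b], hence contributes at most [j * N ^ b.-1]; the parts sum to less
    than [N]. *)
Lemma part_cost_lt b k : good_part (b :: k) -> part_cost N (b :: k) < N ^ b.
Proof.
case/and3P=> sk k0 sumk; have b_gt0 : 0 < b by move: k0; rewrite inE; case: b {sk sumk}.
have N_gt0 : 0 < N by apply: leq_ltn_trans sumk.
apply: (@leq_ltn_trans (\sum_(j <- b :: k) j * N ^ b.-1)).
  rewrite /part_cost big_seq [X in _ <= X]big_seq; apply: leq_sum => j jbk.
  have le_jb : j <= b.
    by move: jbk; rewrite inE => /predU1P[->//|]; apply: sorted_geq_head.
  rewrite -[j in X in _ <= X]card_ord -sum_nat_const; apply: leq_sum => i _.
  by rewrite leq_pexp2l // -ltnS prednK // (leq_trans (ltn_ord i)).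
rewrite -big_distrl /= -sumnE -[X in _ < N ^ X](prednK b_gt0) expnS.
by rewrite ltn_pmul2r // expn_gt0 N_gt0.
Qed.

Lemma good_part_behead k s : good_part (k :: s) -> good_part s.
Proof.
case/and3P=> /path_sorted ss; rewrite inE negb_or => /andP[_ s0] sumk.
by apply/and3P; split=> //; apply: leq_ltn_trans sumk; rewrite leq_addl.
Qed.

(** Common leading parts cancel. If then [b < a], the summand [N ^ b] in the cost of the part [a]
    alone exceeds the whole remaining cost of [t]. *)
Lemma part_cost_lex s t : good_part s -> good_part t ->
  part_cost N s <= part_cost N t -> lex_le s t.
Proof.
rewrite /lex_le; elim: s t => [|a s IHs] [|b t] gs gt //=.
  rewrite part_cost_cons {2}/part_cost big_nil leqn0 addn_eq0.
  have: 0 < a by case/and3P: gs => _; rewrite inE; case: (a).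
  by case: a {gs} => // a _; rewrite big_ord_recl expn0.
rewrite lexi_cons !leEnat; case: (ltngtP a b) => //= [lt_ba|<-]; last first.
  rewrite !part_cost_cons leq_add2l.
  by apply: IHs; [apply: good_part_behead gs|apply: good_part_behead gt].
have := part_cost_lt gt; rewrite [in X in _ -> X]part_cost_cons => lt_t.
rewrite leqNgt => /negP[]; apply: leq_trans lt_t _.
by rewrite (bigD1 (Ordinal lt_ba)) //= -addnA leq_addr.
Qed.

Lemma part_cost_inj s t : good_part s -> good_part t ->
  part_cost N s = part_cost N t -> s = t.
Proof.
move=> gs gt eq_st.
have le_st := part_cost_lex gs gt (eq_leq eq_st).
have le_ts := part_cost_lex gt gs (eq_leq (esym eq_st)).
by apply: (@Order.POrderTheory.le_anti _ (seqlexi nat)); apply/andP.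
Qed.

Lemma part_cost_join ss : part_cost N (join_parts ss) = \sum_(s <- ss) part_cost N s.
Proof.
rewrite /part_cost (perm_big (flatten ss)) /=; last by rewrite perm_sort.
by rewrite big_flatten.
Qed.

End LexCost.

Lemma is_partition_good n N s : (n < N)%N -> is_partition n s -> good_part N s.
Proof. by move=> lt_nN /and3P[ss s0 /eqP sn]; apply/and3P; rewrite sn. Qed.

Lemma join_parts_good N (ss : seq (seq nat)) :
  (forall s, s \in ss -> 0%N \notin s) -> (\sum_(s <- ss) sumn s < N)%N ->
  good_part N (join_parts ss).
Proof.
move=> ss0 sum_ss; apply/and3P; split.
- by apply: sort_sorted => a b; apply: leq_total.
- by rewrite mem_sort; apply/flattenP=> -[s /ss0/negP].
rewrite (@perm_sumn _ (flatten ss)); last by rewrite perm_sort.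
by rewrite sumn_flatten sumnE big_map.
Qed.

(** * Semi-invariants of induced modules *)

Section InducedSemiInv.

Variables (T : finType) (H G : {group {perm T}}) (sHG : H \subset G).
Variables (d : nat) (rH : mx_representation rat H d) (e : bool).
Local Notation iG := (ind_repr sHG rH).
Local Notation Idx := (right_coset H G * 'I_d)%type.

Definition coset_comp (v : 'rV[rat]_#|{: Idx}|) (D : right_coset H G) : 'rV[rat]_d :=
  \row_i v 0 (enum_rank (D, i)).

Lemma coset_comp_ind v g D :
  coset_comp (v *m ind_mx G rH g) D = \sum_(C : right_coset H G)
    let h := (repr (val C) * g * (repr (val D))^-1)%g in
    if h \in H then coset_comp v C *m rH h else 0.
Proof.
apply/rowP=> j; rewrite !mxE summxE.
rewrite (reindex (@enum_rank Idx)) /=; last exact/onW_bij/enum_rank_bij.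
pose F (C : right_coset H G) (i : 'I_d) := v 0 (enum_rank (C, i)) *
  (let h := (repr (val C) * g * (repr (val D))^-1)%g in if h \in H then rH h i j else 0).
rewrite (eq_bigr (fun Ci : Idx => F Ci.1 Ci.2)) => [|[C i] _]; last first.
  by rewrite !mxE !enum_rankK.
rewrite -(pair_bigA _ F) /=; apply: eq_bigr => C _; rewrite /F /=.
case: ifP => _; last by rewrite mxE big1 // => i _; rewrite mulr0.
by rewrite mxE; apply: eq_bigr => i _; rewrite mxE.
Qed.

(** The component at a coset [H r] is acted on by [r^-1 H r] through conjugation back to [H]; a
    nonzero component is therefore semi-invariant for [f \o r]. *)
Lemma ind_semi_inv (C : eqType) (f : T -> C) :
  has_semi_inv iG e f -> exists2 s, s \in G & has_semi_inv rH e (f \o s).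
Proof.
case/has_semi_invP=> v nz vf.
have [D nzD] : exists D, coset_comp v D != 0.
  apply/existsP; apply: contraNT nz; rewrite negb_exists => /forallP v0.
  apply/eqP/rowP=> i; rewrite mxE -[i]enum_valK; case: (enum_val i) => D j.
  by have /negbNE/eqP/rowP/(_ j) := v0 D; rewrite !mxE.
have [GD DD] := repr_right_coset sHG D.
set r := repr (val D) in GD DD; exists r => //.
apply/has_semi_invP; exists (coset_comp v D) => // h Hh; rewrite stab_comp => fh.
have Gh : (h ^ r)%g \in G by rewrite groupJ // (subsetP sHG).
have := congr1 (fun w => coset_comp w D) (vf _ Gh fh); rewrite /= coset_comp_ind.
rewrite (bigD1 D) //= big1 => [|B neq_BD]; last first.
  rewrite -/r conjgE !mulgA; case: ifP => // HB; case/eqP: neq_BD; apply: val_inj.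
  have [GB DB] := repr_right_coset sHG B.
  rewrite DB DD; apply: rcoset_eqP; rewrite mem_rcoset.
  by move: HB; rewrite mulgK groupMr.
rewrite -/r conjgE !mulgA mulgV mul1g mulgK Hh addr0 => ->.
by rewrite -mulgA -conjgE sgpJ; apply/rowP=> i; rewrite !mxE.
Qed.

(** The vector is placed on the trivial coset and symmetrized over [G]. Back on the trivial coset
    only elements of [H] contribute, which yields a nonzero multiple of the vector. *)
Lemma semi_inv_ind (C : eqType) (f : T -> C) :
  has_semi_inv rH e f -> has_semi_inv iG e f.
Proof.
case/has_semi_invP=> v nz vf.
have HG : (H : {set _}) \in rcosets H G.
  by apply/rcosetsP; exists 1%g; rewrite ?group1 ?mulg1.
pose C0 : right_coset H G := exist (fun B => B \in rcosets H G) _ HG.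
have r0 : repr (val C0) = 1%g by apply: repr_group.
pose w : 'rV[rat]_#|{: Idx}| := \row_k (if (enum_val k).1 == C0 then v 0 (enum_val k).2 else 0).
have w0 : coset_comp w C0 = v by apply/rowP=> i; rewrite !mxE enum_rankK eqxx.
have wC B : B != C0 -> coset_comp w B = 0.
  by move=> neqB; apply/rowP=> i; rewrite !mxE enum_rankK (negPf neqB).
rewrite /has_semi_inv; apply: contraNneq nz => S0.
have linC a b : coset_comp (a + b) C0 = coset_comp a C0 + coset_comp b C0.
  by apply/rowP=> i; rewrite !mxE.
have linZ c a : coset_comp (c *: a) C0 = c *: coset_comp a C0.
  by apply/rowP=> i; rewrite !mxE.
have C00 : coset_comp 0 C0 = 0 by apply/rowP=> i; rewrite !mxE.
have : coset_comp (w *m symm_mx iG e f) C0 = #|H :&: stab f|%:R *: v.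
  rewrite mulmx_sumr (big_morph _ linC C00).
  rewrite (eq_bigr (fun s => if s \in H then v else 0)).
    rewrite -big_mkcondr sumr_const scaler_nat; congr (_ *+ _); apply: eq_card => s.
    rewrite unfold_in /= !in_setI andbC; case Hs: (s \in H) => //=.
    by rewrite (subsetP sHG _ Hs).
  move=> s /setIP[Gs fs]; rewrite -scalemxAr linZ coset_comp_ind (bigD1 C0) //= big1.
    rewrite -[H : {set _}]/(val C0) r0 mul1g invg1 mulg1 addr0 w0; case: ifP => [Hs|_].
      by rewrite vf // scalerA sgpK scale1r.
    by rewrite scaler0.
  by move=> B /wC->; rewrite mul0mx if_same.
rewrite S0 mulmx0 C00 => /esym/eqP; rewrite scaler_eq0.
by rewrite (negPf (card_GIstab_neq0 _ _)).
Qed.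

End InducedSemiInv.

(** * Semi-invariants of Specht modules *)

Section LineSums.
Local Open Scope nat_scope.

Variable T : finType.

(** The largest of the distinct values is at least [#|A| - 1]; removing its point allows induction.
    Monotonicity is asked only below [K], since [nth_cost] drops to the default 0 beyond the last
    atom. *)
Lemma inj_sum_ge (K : nat) (h : nat -> nat) (b : T -> nat) (A : {set T}) :
  (forall i j, i <= j -> j < K -> h i <= h j) ->
  {in A &, injective b} -> (forall x, x \in A -> b x < K) ->
  \sum_(j < #|A|) h j <= \sum_(x in A) h (b x).
Proof.
move=> h_mono; move Dn: #|A| => n; elim: n => [|n IHn] in A Dn * => b_inj bK.
  by rewrite big_ord0.
have [x0 Ax0] : exists x, x \in A by apply/card_gt0P; rewrite Dn.
case: (@arg_maxnP _ x0 [in A] b Ax0) => x Ax maxx.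
rewrite big_ord_recr (bigD1 x) //= addnC leq_add //.
  apply: h_mono; last exact: bK.
  have u : uniq [seq b y | y in A] by rewrite map_inj_in_uniq ?enum_uniq // => y z; rewrite !mem_enum; apply: b_inj.
  have sub : {subset [seq b y | y in A] <= iota 0 (b x).+1}.
    by move=> _ /imageP[y Ay ->]; rewrite mem_iota ltnS; apply: maxx.
  by have := uniq_leq_size u sub; rewrite size_iota size_image Dn ltnS.
have DA : #|A :\ x| = n by apply/eqP; rewrite -eqSS -Dn (cardsD1 x A) Ax.
rewrite (eq_bigl [in A :\ x]) => [|y]; last by rewrite !inE andbC.
apply: IHn => // [y z|y]; rewrite !inE => /andP[_ Ay]; last exact: bK.
by case/andP=> _; apply: b_inj.
Qed.

Variables (ls : seq nat) (l : T -> nat).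
Hypothesis card_l : forall i, #|[set x | l x == i]| = nth 0 ls i.

Lemma sum_lines (G : T -> nat) :
  \sum_x G x = \sum_(i < size ls) \sum_(x in [set x | l x == i]) G x.
Proof.
have lt_l x : l x < size ls.
  rewrite ltnNge; apply/negP=> le_l; have := card_l (l x).
  by rewrite nth_default // => /cards0_eq/setP/(_ x); rewrite !inE eqxx.
rewrite (partition_big (fun x => Ordinal (lt_l x)) xpredT) //=.
by apply: eq_bigr => i _; apply: eq_bigl => x; rewrite inE -val_eqE.
Qed.

Lemma lines_sum_ge K h (b : T -> nat) :
  (forall i j, i <= j -> j < K -> h i <= h j) ->
  joint_inj l b -> (forall x, b x < K) ->
  \sum_(r <- ls) \sum_(j < r) h j <= \sum_x h (b x).
Proof.
move=> h_mono lb bK; rewrite sum_lines -(sum_parts ls (fun r => \sum_(j < r) h j)).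
apply: leq_sum => i _; rewrite -card_l; apply: inj_sum_ge h_mono _ _ => // x y.
by rewrite !inE => /eqP lx /eqP ly; apply: lb; rewrite lx.
Qed.

Lemma lines_sum_eq h (c : T -> nat) :
  joint_inj l c -> (forall x, below l c x = c x) ->
  \sum_x h (c x) = \sum_(r <- ls) \sum_(j < r) h j.
Proof.
move=> lc downc; rewrite sum_lines -(sum_parts ls (fun r => \sum_(j < r) h j)).
apply: eq_bigr => i _; rewrite -card_l.
case: (set_0Vmem [set x | l x == i]) => [->|[y]]; first by rewrite big_set0 cards0 big_ord0.
rewrite inE => /eqP ly.
have := column_values y lc downc; rewrite ly => mem_c.
rewrite -big_enum -(big_map c xpredT h) /= -(big_mkord xpredT h) /index_iota subn0.
apply: perm_big; apply: uniq_perm => //; last exact: iota_uniq.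
rewrite map_inj_in_uniq ?enum_uniq // => x z.
by rewrite !mem_enum !inE => /eqP lx /eqP lz; apply: lc; rewrite lx.
Qed.

End LineSums.

Lemma below_lt_card (T : finType) (f g : T -> nat) x : (below f g x < #|T|)%N.
Proof.
rewrite /below -cardsT; apply: proper_card; apply/properP; split; first exact: subsetT.
by exists x; rewrite ?inE // ltnn andbF.
Qed.

(** The sizes of the sets on which a present colouring must be injective: rows of a tabloid for the
    sign character, columns of a tableau for the trivial one. *)
Definition lines (e : bool) (nu : seq nat) := if e then nu else conj_part nu.

Section SpechtLines.

Variables (T : finType) (nu : seq nat).
Hypothesis nu_sorted : sorted geq nu.
Local Notation M := (young_repr T nu).

Lemma tableau_card_row_nth (t : tableau T nu) i :
  #|[set x | tab_row t x == i :> nat]| = nth 0%N nu i.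
Proof.
have [lt_i|le_i] := ltnP i (size nu).
  by rewrite -(tableau_card_row nu_sorted t (Ordinal lt_i)).
rewrite nth_default //; apply/eqP; rewrite cards_eq0; apply/eqP/setP=> x; rewrite !inE.
by apply/eqP=> ri; have := ltn_ord (tab_row t x); rewrite ri ltnNge le_i.
Qed.

Lemma tableau_card_col (t : tableau T nu) j :
  #|[set x | tab_col t x == j :> nat]| = nth 0%N (conj_part nu) j.
Proof.
have -> : nth 0%N (conj_part nu) j = count (fun p => j < p)%N nu.
  rewrite /conj_part; have [lt_j|le_j] := ltnP j (head 0%N nu).
    by rewrite (nth_map 0%N) ?size_iota // nth_iota.
  rewrite nth_default ?size_map ?size_iota //; apply/esym/eqP.
  rewrite -leqn0 leqNgt -has_count -all_predC; apply/allP=> _ /(nthP 0%N)[i _ <-].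
  by rewrite /= -leqNgt; apply: leq_trans (cell_width nu_sorted i) le_j.
rewrite -sum1_card big_mkcond /=.
rewrite (eq_bigr (fun x => (tab_col t x == j :> nat) : nat)) => [|x _]; last first.
  by rewrite inE; case: ifP.
rewrite (sum_tableau nu_sorted t (fun _ a => (a == j) : nat)).
rewrite -sum1_count [RHS]big_mkcond -(sum_parts nu (fun p => if (j < p)%N then 1%N else 0%N)).
apply: eq_bigr => i _; case: ifP => [lt_j|/negbT]; last first.
  rewrite -leqNgt => le_j; rewrite big1 // => a _.
  by case: eqP => // aj; have := ltn_ord a; rewrite aj ltnNge le_j.
rewrite (bigD1 (Ordinal lt_j)) //= eqxx big1 // => a neq_a.
by case: eqP => // aj; case/eqP: neq_a; apply: val_inj.
Qed.

Lemma tableau_down_col (t : tableau T nu) y :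
  below (fun x => tab_row t x) (fun x => tab_col t x) y = tab_col t y.
Proof.
apply/eqP; rewrite eqn_leq; apply/andP; split.
  apply: (@below_le _ _ (fun x => tab_col t x : nat) y).
  by move=> x z /ord_inj cx /ord_inj rx; apply: (tableau_inj cx rx).
apply: (@below_ge _ _ (fun x => tab_col t x : nat) y) => j lt_j.
have := ltn_trans lt_j (tab_col_lt t y).
by case/(tableau_cell nu_sorted t)=> x [rx cx]; exists x.
Qed.

Let tableau_injn (t : tableau T nu) :
  joint_inj (fun x => tab_row t x : nat) (fun x => tab_col t x : nat).
Proof. by move=> x z /ord_inj cx /ord_inj rx; apply: (tableau_inj cx rx). Qed.

(** For the sign, the polytabloid of [t] with its column colouring serves; for the trivial
    character, the row symmetrization of that polytabloid with the row colouring. Either colouring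
    takes the values 0, 1, ... along every line. *)
Lemma specht_lower e : tableau T nu ->
  exists2 c : T -> nat, has_semi_inv (specht T nu) e c &
    (forall x, (c x < #|T|)%N) /\
    (forall h, \sum_x h (c x) = \sum_(r <- lines e nu) \sum_(j < r) h j)%N.
Proof.
move=> t; have tS := specht_spaceP t; case: e.
  exists (fun x => tab_col t x); last split.
  - apply/has_semi_inv_submod; exists (polytabloid t); first exact: polytabloid_neq0.
    split=> //; apply: semi_inv_sub (@polytabloid_semi_inv _ _ nu_sorted t) => x y.
    exact: ord_inj.
  - by move=> x; rewrite -tableau_down_col below_lt_card.
  move=> h; apply: (@lines_sum_eq _ _ (fun x => tab_row t x : nat)) => [i||x].
  - exact: tableau_card_row_nth.
  - exact: tableau_injn.
  exact: tableau_down_col.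
exists (fun x => tab_row t x); last split.
- apply/has_semi_inv_submod; exists (polytabloid t *m symm_mx M false (tab_row t)).
    (* The coefficient at the tabloid of [t] is the order of the row stabiliser: each row
       permutation fixes this tabloid, whose coefficient in the polytabloid is 1. *)
    apply/eqP=> /rowP/(_ (enum_rank (tab_of nu_sorted t))).
    rewrite mulmx_sumr summxE (eq_bigr (fun _ => 1)) => [|s].
      rewrite sumr_const mxE => /eqP; rewrite pnatr_eq0 -leqn0 leqNgt.
      by rewrite (cardG_gt0 [group of [set: {perm T}] :&: stab (tab_row t)]).
    case/setIP=> _ st; rewrite /sgp expr0 scale1r.
    rewrite -(polytabloid_diag nu_sorted t) [in LHS](tabloid_row_sum (polytabloid t)).
    rewrite mulmx_suml summxE (bigD1 (tab_of nu_sorted t)) //= big1 ?addr0.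
      rewrite -scalemxAl tdelta_act mxE.
      have -> : trelabel (tab_of nu_sorted t) s = tab_of nu_sorted t.
        apply: val_inj; apply/ffunP=> x; rewrite !ffunE.
        by have := stabP _ _ st ((s^-1)%g x); rewrite permKV.
      by rewrite !mxE !eqxx mulr1.
    move=> k neq_k; rewrite -scalemxAl tdelta_act !mxE eqxx /= (inj_eq enum_rank_inj).
    case: eqP => [Dk|]; last by rewrite mulr0.
    case/eqP: neq_k; apply: val_inj; apply/ffunP=> x; rewrite /= ffunE.
    have := congr1 (fun k : tabloid T nu => val k (s x)) Dk; rewrite /= !ffunE permK => <-.
    exact: (stabP _ _ st).
  split; last by apply: semi_inv_sub (@symm_mx_inv _ _ _ M false _ (tab_row t) _ (polytabloid t)) => x y; apply: ord_inj.
  rewrite mulmx_sumr summx_sub // => s _; rewrite -scalemxAr scalemx_sub //.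
  apply: submx_trans (submxMr _ tS) _.
  by apply: (mxmoduleP (specht_module T nu)); rewrite inE.
- by move=> x; rewrite -(tableau_down_row nu_sorted) below_lt_card.
move=> h; apply: (@lines_sum_eq _ _ (fun x => tab_col t x : nat)) => [i||x].
- exact: tableau_card_col.
- by move=> x y cxy rxy; exact: (@tableau_injn t x y rxy cxy).
exact: tableau_down_row.
Qed.

(** The transposition lies in [stab b] but acts on [w] by the opposite of the sign demanded by
    [e]. *)
Lemma symm_kill (w : 'rV_#|{: tabloid T nu}|) (e : bool) (b : T -> nat) x y :
  x != y -> b x = b y -> w *m M (tperm x y) = - (-1) ^+ e *: w ->
  w *m symm_mx M e b = 0.
Proof.
move=> neq_xy bxy wxy.
have : w *m symm_mx M e b = - (w *m symm_mx M e b).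
  have := congr1 (mulmx w) (@symm_mxMl _ _ _ M e _ _ _ (in_setT _) (stab_tperm bxy)).
  rewrite mulmxA wxy sgp_tperm neq_xy andbT -scalemxAl -scalemxAr.
  move/(congr1 (fun u => (-1) ^+ e *: u)); rewrite !scalerA mulrN -!expr2 sqrr_sign.
  by rewrite scaleNr !scale1r => {1}<-.
move/eqP; rewrite -subr_eq0 opprK -mulr2n -scaler_nat scaler_eq0 pnatr_eq0 /=.
by move/eqP.
Qed.

(** Some tabloid (sign) or polytabloid (trivial character) survives symmetrization, and [symm_kill]
    then makes [b] injective along the rows of the tabloid or the columns of the tableau. *)
Lemma specht_upper e K h (b : T -> nat) :
  has_semi_inv (specht T nu) e b ->
  (forall i j, i <= j -> j < K -> h i <= h j)%N -> (forall x, b x < K)%N ->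
  (\sum_(r <- lines e nu) \sum_(j < r) h j <= \sum_x h (b x))%N.
Proof.
move=> /has_semi_inv_submod[v nz_v [vS /semi_inv_symm vb]] h_mono bK.
have nz : v *m symm_mx M e b != 0.
  by rewrite vb scaler_eq0 negb_or nz_v (card_GIstab_neq0 _ _).
case: e vb nz => _ nz.
  have [k nzk] : exists k, tdelta k *m symm_mx M true b != 0.
    apply/existsP; apply: contraNT nz; rewrite negb_exists => /forallP k0.
    rewrite (tabloid_row_sum v) mulmx_suml big1 // => k _.
    by have /negbNE/eqP := k0 k; rewrite -scalemxAl => ->; rewrite scaler0.
  apply: (@lines_sum_ge _ _ (fun x => val k x : nat) _ K) => // [i|x y kxy bxy].
    have [lt_i|le_i] := ltnP i (size nu).
      by have /forallP/(_ (Ordinal lt_i))/eqP/= <- := valP k.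
    rewrite /lines nth_default //; apply/eqP; rewrite cards_eq0; apply/eqP/setP=> x; rewrite !inE.
    by apply/eqP=> ri; have := ltn_ord (val k x); rewrite ri ltnNge le_i.
  apply/eqP; apply: contraNT nzk => neq_xy; apply/eqP.
  apply: (symm_kill neq_xy bxy); rewrite expr1 opprK scale1r tdelta_act.
  congr tdelta; apply: val_inj; apply/ffunP=> z; rewrite ffunE /= tpermV.
  by case: tpermP => [->|->|] //; apply: ord_inj.
have [t nzt] : exists t : tableau T nu, polytabloid t *m symm_mx M false b != 0.
  apply/existsP; apply: contraNT nz; rewrite negb_exists => /forallP t0.
  apply/eqP/sub_kermxP; apply: submx_trans vS _.
  rewrite genmxE; apply/row_subP=> i; rewrite rowK; apply/sub_kermxP/eqP/negbNE/t0.
apply: (@lines_sum_ge _ _ (fun x => tab_col t x : nat) _ K) => // [i|x y /ord_inj cxy bxy].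
  exact: tableau_card_col.
apply/eqP; apply: contraNT nzt => neq_xy; apply/eqP.
apply: (symm_kill neq_xy bxy).
rewrite expr0 (@polytabloid_semi_inv _ _ nu_sorted t _ (in_setT _) (stab_tperm cxy)).
by rewrite sgp_tperm neq_xy expr1.
Qed.

End SpechtLines.

(** * Coordinates of tensor products *)

(** The row-major index of a pair. The recursion follows that of [tprod], whose entries can then be
    computed by induction. *)
Fixpoint tidx m n : 'I_m -> 'I_n -> 'I_(m * n) :=
  match m return 'I_m -> 'I_n -> 'I_(m * n) with
  | 0 => fun i _ => match notF (ltn_ord i) with end
  | m'.+1 => fun i k =>
      match @split 1 m' i with
      | inl _ => lshift (m' * n) k
      | inr i' => rshift n (tidx i' k)
      end
  end.

Lemma tidxS0 m n (k : 'I_n) : tidx (ord0 : 'I_m.+1) k = lshift (m * n) k.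
Proof. by rewrite /=; case: splitP => [j _|j /=]. Qed.

Lemma tidxSl m n (i : 'I_m) (k : 'I_n) :
  tidx (lift ord0 i : 'I_m.+1) k = rshift n (tidx i k).
Proof.
rewrite /=; case: splitP => [j|j] /=; first by case: j => -[].
by rewrite /bump /= => /addnI/ord_inj->.
Qed.

Lemma tidx_sum m n (F : 'I_(m * n) -> rat) :
  \sum_x F x = \sum_(i < m) \sum_(k < n) F (tidx i k).
Proof.
elim: m F => [|m IHm] F; first by rewrite !big_ord0.
rewrite big_split_ord big_ord_recl; congr (_ + _).
  by apply: eq_bigr => k _; rewrite tidxS0.
by rewrite IHm; apply: eq_bigr => i _; apply: eq_bigr => k _; rewrite tidxSl.
Qed.

Lemma tidx_surj m n (x : 'I_(m * n)) : exists i k, x = tidx i k :> 'I_(m * n).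
Proof.
elim: m x => [|m IHm] x; first by case: x.
rewrite -(splitK x); case: (split x) => [k|y].
  by exists ord0, k; rewrite tidxS0.
by have [i [k ->]] := IHm y; exists (lift ord0 i), k; rewrite tidxSl.
Qed.

Lemma trow_tidx n1 (A : 'rV[rat]_n1) m2 n2 (B : 'M_(m2, n2)) k j l :
  trow A B k (tidx j l) = A 0 j * B k l.
Proof.
elim: n1 A j => [|n1 IH] A j; first by case: j.
case: (unliftP ord0 j) => [j'|] ->.
  rewrite tidxSl [trow _ _]/= row_mxEr IH !mxE; congr (A _ _ * _); exact: val_inj.
rewrite tidxS0 [trow _ _]/= row_mxEl !mxE; congr (A _ _ * _); exact: val_inj.
Qed.

Lemma tprod_tidx m1 n1 (A : 'M[rat]_(m1, n1)) m2 n2 (B : 'M_(m2, n2)) i k j l :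
  tprod A B (tidx i k) (tidx j l) = A i j * B k l.
Proof.
elim: m1 A i => [|m1 IH] A i; first by case: i.
case: (unliftP ord0 i) => [i'|] ->.
  rewrite tidxSl [tprod _ _]/= col_mxEd IH !mxE; congr (A _ _ * _); exact: val_inj.
rewrite tidxS0 [tprod _ _]/= col_mxEu trow_tidx !mxE; congr (A _ _ * _); exact: val_inj.
Qed.

Definition tcoord m n (v : 'rV[rat]_(m * n)) : 'M[rat]_(m, n) :=
  \matrix_(i, k) v 0 (tidx i k).

Lemma tcoord_inj m n : injective (@tcoord m n).
Proof.
move=> v w /matrixP eq_vw; apply/rowP=> x; have [i [k ->]] := tidx_surj x.
by have := eq_vw i k; rewrite !mxE.
Qed.

Lemma tcoord_is_linear m n : linear (@tcoord m n).
Proof. by move=> a v w; apply/matrixP=> i k; rewrite !mxE. Qed.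

HB.instance Definition _ m n :=
  GRing.isLinear.Build _ _ _ _ (@tcoord m n) (@tcoord_is_linear m n).

Lemma tcoord_tprod m1 n1 m2 n2 (v : 'rV_(m1 * m2)) (A : 'M_(m1, n1)) (B : 'M_(m2, n2)) :
  tcoord (v *m tprod A B) = A^T *m tcoord v *m B.
Proof.
apply/matrixP=> j l; rewrite !mxE tidx_sum exchange_big /=; apply: eq_bigr => k _.
rewrite !mxE big_distrl /=; apply: eq_bigr => i _.
by rewrite tprod_tidx !mxE mulrA [v _ _ * _]mulrC.
Qed.

Lemma tcoord_pure m n (a : 'rV_m) (b : 'rV_n) :
  tcoord (tprod a b : 'rV_(m * n)) = a^T *m b.
Proof.
apply/matrixP=> i k; rewrite mxE.
have -> : tprod a b (0 : 'I_1) (tidx i k) = tprod a b (tidx ord0 ord0) (tidx i k).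
  by rewrite [tidx ord0 ord0]tidxS0; congr (tprod a b _ _); apply: val_inj.
by rewrite tprod_tidx !mxE big_ord1 !mxE.
Qed.

(** * Signs in the wreath product *)

Section Extension.

Variables (A T : finType) (i : A -> T).
Hypothesis i_inj : injective i.

Definition ext_fun (s : {perm A}) (x : T) : T :=
  if [pick a | i a == x] is Some a then i (s a) else x.

Lemma ext_fun_in s a : ext_fun s (i a) = i (s a).
Proof. by rewrite /ext_fun; case: pickP => [b /eqP/i_inj->//|/(_ a)/eqP]. Qed.

Lemma ext_fun_out s x : (forall a, i a != x) -> ext_fun s x = x.
Proof. by move=> ix; rewrite /ext_fun; case: pickP => // a /eqP ia; have /eqP[] := ix a. Qed.

Lemma ext_caseP x : (exists a, x = i a) \/ (forall a, i a != x).
Proof.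
case: (pickP (fun a => i a == x)) => [a /eqP<-|ix]; first by left; exists a.
by right=> a; rewrite ix.
Qed.

Lemma ext_funK s : cancel (ext_fun s) (ext_fun s^-1).
Proof.
move=> x; case: (ext_caseP x) => [[a ->]|ix]; first by rewrite !ext_fun_in permK.
by rewrite !ext_fun_out // => a; rewrite ext_fun_out.
Qed.

Definition ext s : {perm T} := perm (can_inj (ext_funK s)).

Lemma extM s r : ext (s * r) = (ext s * ext r)%g.
Proof.
apply/permP=> x; rewrite permM !permE; case: (ext_caseP x) => [[a ->]|ix].
  by rewrite !ext_fun_in permM.
by rewrite !ext_fun_out.
Qed.

Lemma ext1 : ext 1 = 1%g.
Proof. by apply: (mulgI (ext 1)); rewrite -extM !mulg1. Qed.

Lemma ext_tperm a b : ext (tperm a b) = tperm (i a) (i b).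
Proof.
apply/permP=> x; rewrite permE; case: (ext_caseP x) => [[c ->]|ix].
  rewrite ext_fun_in; case: tpermP => [->|->|/eqP ca /eqP cb]; rewrite ?tpermL ?tpermR //.
  by rewrite tpermD // (inj_eq i_inj) eq_sym.
by rewrite ext_fun_out // tpermD // eq_sym.
Qed.

(** An extended transposition is a transposition, and transpositions generate. *)
Lemma sgp_ext e s : sgp e (ext s) = sgp e s.
Proof.
have [ts -> _] := prod_tpermP s; elim: ts => [|t ts IH].
  by rewrite big_nil ext1 !sgp1.
by rewrite big_cons extM !sgpM IH ext_tperm !sgp_tperm (inj_eq i_inj).
Qed.

End Extension.

Section WreathElements.

Variables (m n : nat).
Local Notation W := (wreath m n).

Definition base_fun (s : 'I_n -> 'S_m) (x : 'I_n * 'I_m) := (x.1, s x.1 x.2).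

Lemma base_fun_inj s : injective (base_fun s).
Proof. by move=> [i x] [j y] [/= <- /perm_inj->]. Qed.

Definition base_perm s := perm (@base_fun_inj s).

Lemma base_permE s i x : base_perm s (i, x) = (i, s i x).
Proof. by rewrite permE. Qed.

Definition lift_fun (t : 'S_n) (x : 'I_n * 'I_m) := (t x.1, x.2).

Lemma lift_fun_inj t : injective (lift_fun t).
Proof. by move=> [i x] [j y] [/perm_inj-> ->]. Qed.

Definition lift_block t := perm (@lift_fun_inj t).

Lemma lift_blockE t i x : lift_block t (i, x) = (t i, x).
Proof. by rewrite permE. Qed.

Lemma base_perm_wreath s : base_perm s \in W.
Proof. by apply/wreathP=> -[i x] [j y] /= <-; rewrite !base_permE. Qed.

Lemma lift_block_wreath t : lift_block t \in W.
Proof. by apply/wreathP=> -[i x] [j y] /= <-; rewrite !lift_blockE. Qed.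

Lemma fibre_base s i : fibre_perm (base_perm s) i = s i.
Proof.
by apply/permP=> x; have := wreathE i x (base_perm_wreath s); rewrite base_permE => -[_ <-].
Qed.

Lemma fibre_lift t i : fibre_perm (lift_block t) i = 1%g.
Proof.
by apply/permP=> x; have := wreathE i x (lift_block_wreath t); rewrite lift_blockE perm1 => -[_ <-].
Qed.

Lemma wreath_decomp s : s \in W ->
  s = (base_perm (fibre_perm s) * lift_block (block_perm s))%g.
Proof.
by move=> sW; apply/permP=> -[i x]; rewrite permM base_permE lift_blockE -wreathE.
Qed.

Lemma sgp_base e s : sgp e (base_perm s) = \prod_i sgp e (s i).
Proof.
have inj_i (i : 'I_n) : injective (fun a : 'I_m => (i, a)) by move=> a b [].
pose E i := ext (inj_i i).
have prodE (r : seq 'I_n) j x : uniq r ->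
    (\prod_(i <- r) E i (s i))%g (j, x) = if j \in r then (j, s j x) else (j, x).
  elim: r j x => [|i r IH] j x; first by rewrite big_nil perm1.
  case/andP=> ir ur; rewrite big_cons permM inE permE.
  have [->|neq_ji] := eqVneq j i.
    by rewrite (ext_fun_in (inj_i i)) ?IH // ?(negPf ir).
  by rewrite ext_fun_out ?IH // => a; rewrite xpair_eqE eq_sym (negPf neq_ji).
have -> : base_perm s = (\prod_i E i (s i))%g.
  by apply/permP=> -[j x]; rewrite base_permE prodE ?index_enum_uniq // mem_index_enum.
rewrite (big_morph (sgp e) (@sgpM _ e) (sgp1 _ e)); apply: eq_bigr => i _.
by rewrite /E sgp_ext.
Qed.

(** A block permutation acts on [m] copies of ['I_n], one for each position in a block, whence the
    sign of [t] to the power [m]. This is where the parity of [m] enters. *)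
Lemma sgp_lift t : sgp true (lift_block t) = sgp (odd m) t.
Proof.
have inj_x (x : 'I_m) : injective (fun i : 'I_n => (i, x)) by move=> a b [].
have prodE (r : seq 'I_m) j x : uniq r ->
    (\prod_(y <- r) ext (inj_x y) t)%g (j, x) = if x \in r then (t j, x) else (j, x).
  elim: r j x => [|y r IH] j x; first by rewrite big_nil perm1.
  case/andP=> yr ur; rewrite big_cons permM inE permE.
  have [->|neq_xy] := eqVneq x y.
    by rewrite (ext_fun_in (inj_x y)) ?IH // ?(negPf yr).
  by rewrite ext_fun_out ?IH // => a; rewrite xpair_eqE [y == x]eq_sym (negPf neq_xy) andbF.
have -> : lift_block t = (\prod_y ext (inj_x y) t)%g.
  by apply/permP=> -[j x]; rewrite lift_blockE prodE ?index_enum_uniq // mem_index_enum.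
rewrite (big_morph (sgp true) (@sgpM _ true) (sgp1 _ true)).
rewrite (eq_bigr (fun _ => sgp true t)) => [|y _]; last by rewrite sgp_ext.
rewrite prodr_const card_ord /sgp /=; case: (odd_perm t).
  by rewrite expr1 andbT signr_odd.
by rewrite expr0 expr1n andbF.
Qed.

Lemma sgp_wreath s : s \in W ->
  sgp true s = \prod_i sgp true (fibre_perm s i) * sgp (odd m) (block_perm s).
Proof. by move=> sW; rewrite {1}(wreath_decomp sW) sgpM sgp_base sgp_lift. Qed.

Lemma block_lift t : (0 < m)%N -> block_perm (lift_block t) = t.
Proof.
move=> m_gt0; apply/permP=> i; have := wreathE i (Ordinal m_gt0) (lift_block_wreath t).
by rewrite lift_blockE => -[<-].
Qed.

Lemma block_base s : (0 < m)%N -> block_perm (base_perm s) = 1%g.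
Proof.
move=> m_gt0; apply/permP=> i; have := wreathE i (Ordinal m_gt0) (base_perm_wreath s).
by rewrite base_permE perm1 => -[<-].
Qed.

End WreathElements.

(** * Semi-invariants of W (/) Z *)

Section WeightSpace.

Variables (T : finType) (G : {group {perm T}}) (d : nat).
Variables (rG : mx_representation rat G d) (C : eqType) (f : T -> C).

Definition wproj : 'M[rat]_d := #|G :&: stab f|%:R^-1 *: symm_mx rG true f.

Definition wdim : nat := \rank wproj.

(** With [wbasis], a rank factorization of the idempotent [wproj]. The factors are kept square and
    padded by [pid_mx], so that blocks with spaces of different dimensions share the index type
    ['I_d]. *)
Definition wcoord : 'M[rat]_d := col_ebase wproj *m pid_mx wdim.

Definition wbasis : 'M[rat]_d := pid_mx wdim *m row_ebase wproj.

Lemma wprojM s : s \in G -> s \in stab f -> wproj *m rG s = sgp true s *: wproj.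
Proof.
by move=> Gs fs; rewrite -scalemxAl symm_mxM // !scalerA mulrC.
Qed.

Lemma wprojK : wproj *m wproj = wproj.
Proof.
rewrite {2}/wproj -scalemxAr semi_inv_symm; last first.
  by move=> s Gs fs; apply: wprojM.
by rewrite scalerA mulVf ?scale1r // card_GIstab_neq0.
Qed.

Lemma wcoordK : wcoord *m wbasis = wproj.
Proof.
by rewrite /wcoord /wbasis mulmxA -(mulmxA (col_ebase _)) pid_mx_id ?rank_leq_row // mulmx_ebase.
Qed.

Lemma wbasisE : wbasis = invmx (col_ebase wproj) *m wproj.
Proof. by rewrite -{2}[wproj]mulmx_ebase !mulmxA mulVmx ?col_ebase_unit // mul1mx. Qed.

Lemma wbasisK : wbasis *m wcoord = pid_mx wdim.
Proof.
have e0 : col_ebase wproj *m pid_mx wdim *m row_ebase wproj = wproj by apply: mulmx_ebase.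
have e1 : wproj = wcoord *m row_ebase wproj by rewrite -[LHS]e0.
rewrite wbasisE (_ : wcoord = wproj *m invmx (row_ebase wproj)).
  rewrite mulmxA -(mulmxA (invmx _)) wprojK -{2}e0 !mulmxA mulVmx ?col_ebase_unit //.
  by rewrite mul1mx mulmxK ?row_ebase_unit.
by rewrite {1}e1 mulmxK ?row_ebase_unit.
Qed.

Lemma wbasisM s : s \in G -> s \in stab f -> wbasis *m rG s = sgp true s *: wbasis.
Proof. by move=> Gs fs; rewrite wbasisE -mulmxA wprojM // scalemxAr. Qed.

Lemma wcoord0 i (k : 'I_d) : (wdim <= k)%N -> wcoord i k = 0.
Proof.
move=> le_k; rewrite mxE big1 // => j _; rewrite mxE.
case: eqP => [jk|_]; last by rewrite mulr0.
by rewrite jk [(k < _)%N]ltnNge le_k mulr0.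
Qed.

End WeightSpace.

Section TensorFamily.

Variables (n d : nat).
Local Notation D := {ffun 'I_n -> 'I_d}.

(** A form of [tens_pow_mx] in which the matrices vary with the factor independently of the place
    permutation; this family is closed under products. *)
Definition tens (A : 'I_n -> 'M[rat]_d) (s : 'S_n) : 'M[rat]_#|D| :=
  fin_mx (fun a b : D => \prod_i A i (a i) (b (s i))).

Lemma tensM A s B r :
  tens A s *m tens B r = tens (fun i => A i *m B (s i)) (s * r)%g.
Proof.
rewrite /tens fin_mxM; apply: eq_fin_mx => a b.
rewrite [RHS](eq_bigr (fun i => \sum_k A i (a i) k * B (s i) k (b (r (s i))))); last first.
  by move=> i _; rewrite mxE permM.
rewrite bigA_distr_bigA /= (reindex (fun c : D => [ffun i => c ((s^-1)%g i)])) /=; last first.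
  exists (fun c : D => [ffun i => c (s i)]) => c _; apply/ffunP=> i.
    by rewrite !ffunE permK.
  by rewrite !ffunE permKV.
apply: eq_bigr => c _; rewrite [X in _ * X](reindex_inj (@perm_inj _ s)).
by rewrite -big_split; apply: eq_bigr => i _; rewrite !ffunE permK.
Qed.

Lemma eq_tens A B s : (forall i, A i = B i) -> tens A s = tens B s.
Proof.
by move=> AB; apply: eq_fin_mx => a b; apply: eq_bigr => i _; rewrite AB.
Qed.

Lemma tensZ (c : 'I_n -> rat) A s :
  tens (fun i => c i *: A i) s = (\prod_i c i) *: tens A s.
Proof.
apply/matrixP=> x y; rewrite !mxE -big_split; apply: eq_bigr => i _; by rewrite mxE.
Qed.

Lemma tens_sum (S : finType) (Q : 'I_n -> pred S) (A : 'I_n -> S -> 'M[rat]_d) s :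
  tens (fun i => \sum_(x | Q i x) A i x) s =
  \sum_(x in family Q) tens (fun i => A i (x i)) s.
Proof.
apply/matrixP=> a b; rewrite !mxE summxE.
rewrite (eq_bigr (fun i => \sum_(x | Q i x) A i x (enum_val a i) (enum_val b (s i)))); last first.
  by move=> i _; rewrite summxE.
rewrite bigA_distr_big_dep; apply: eq_bigr => x _; by rewrite mxE.
Qed.

End TensorFamily.

Section OslashSemiInv.

Variables (m n d z : nat).
Hypothesis m_gt0 : (0 < m)%N.
Variables (rW : mx_representation rat [set: 'S_m] d).
Variables (rZ : mx_representation rat [set: 'S_n] z).
Local Notation W := (wreath m n).
Local Notation rV := (prod_repr (tens_pow_repr n rW) (infl_repr m rZ)).
Local Notation D := {ffun 'I_n -> 'I_d}.

Variables (C : eqType) (F : 'I_n -> 'I_m -> C).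

(* Blocks carrying the same multiset of colours are coloured identically, so  *)
(* that the block permutations of the stabiliser act on the colouring itself. *)
Hypothesis F_normal : forall i j (s : 'S_m), (forall x, F j (s x) = F i x) -> F j =1 F i.

Definition block_colouring (x : 'I_n * 'I_m) : C := F x.1 x.2.

Local Notation f := block_colouring.
Local Notation A i := (wcoord rW (F i)).
Local Notation B i := (wbasis rW (F i)).

Lemma tcoord_act v s :
  tcoord (v *m rV s) = (tens (fun i => rW (fibre_perm s i)) (block_perm s))^T
    *m tcoord v *m rZ (block_perm s).
Proof. exact: tcoord_tprod. Qed.

Lemma eq_wcoord i j : F j =1 F i -> A j = A i.
Proof.
move=> Fji; suff eq_p : wproj rW (F j) = wproj rW (F i) by rewrite /wcoord /wdim eq_p.
rewrite /wproj /symm_mx (@eq_stab _ _ _ (F j) (F i)) // => x y.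
by rewrite !Fji.
Qed.

Definition atom_colouring (k : 'I_n -> 'I_d) (i : 'I_n) : {ffun 'I_m -> C} * 'I_d :=
  ([ffun x => F i x], k i).

Lemma stab_atom k (t : 'S_n) :
  reflect (forall i, F (t i) =1 F i /\ k (t i) = k i) (t \in stab (atom_colouring k)).
Proof.
apply: (iffP (stabP _ _)) => tP i; have := tP i.
  by case=> /ffunP Fi ->; split=> // x; have := Fi x; rewrite !ffunE.
by case=> Fi ki; congr (_, _) => //; apply/ffunP=> x; rewrite !ffunE Fi.
Qed.

Lemma wreath_stab s : s \in W -> s \in stab f ->
  (forall i, F (block_perm s i) =1 F i) /\ (forall i, fibre_perm s i \in stab (F i)).
Proof.
move=> sW /stabP sf.
have fs i x : F (block_perm s i) (fibre_perm s i x) = F i x.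
  by have := sf (i, x); rewrite wreathE.
have FE i : F (block_perm s i) =1 F i by apply: F_normal (fs i).
by split=> // i; apply/stabP=> x; rewrite -[RHS](fs i) FE.
Qed.

(** Coordinates of a semi-invariant are taken in the tensor basis formed from the blocks' bases of
    sign vectors. A nonzero coordinate is a vector of [rZ], on which block permutations preserving
    both colourings and basis indices act by the sign to the power [m]. *)
Lemma oslash_semi_inv_atoms :
  has_semi_inv rV true f ->
  exists k : {ffun 'I_n -> 'I_d}, (forall i, (k i < wdim rW (F i))%N) /\
    has_semi_inv rZ (odd m) (atom_colouring k).
Proof.
case/has_semi_invP=> v nz vf; pose X := tcoord v.
have nzX : X != 0.
  by apply: contraNneq nz => X0; apply/eqP/tcoord_inj; rewrite -/X X0 linear0.
have Xf s : s \in W -> s \in stab f ->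
    (tens (fun i => rW (fibre_perm s i)) (block_perm s))^T *m X *m rZ (block_perm s)
    = sgp true s *: X.
  by move=> sW sf; rewrite -tcoord_act vf // linearZ.
(* Base permutations preserving each block colouring act on [v] by the sign, so signed averaging
   over them leaves [v] fixed. *)
have XP : (tens (fun i => wproj rW (F i)) 1)^T *m X = X.
  rewrite tensZ /symm_mx tens_sum linearZ /= linear_sum /= -scalemxAl mulmx_suml.
  rewrite (eq_bigr (fun _ => X)) => [|s sF].
    rewrite sumr_const -scaler_nat scalerA card_family.
    rewrite foldrE big_map big_enum /= natr_prod -big_split /= big1 ?scale1r // => i _.
    apply: mulVf; exact: card_GIstab_neq0.
  rewrite (_ : tens _ _ = (\prod_i sgp true (s i)) *: tens (fun i => rW (s i)) 1); last first.
    by rewrite -tensZ.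
  rewrite linearZ /= -scalemxAl -(sgp_base true).
  have sP i : s i \in stab (F i) by have /familyP/(_ i) := sF; rewrite inE => /andP[].
  have sf : base_perm s \in stab f.
    by apply/stabP=> -[i x]; rewrite base_permE /f /=; apply: (stabP _ _ (sP i)).
  have := Xf _ (base_perm_wreath s) sf; rewrite block_base // repr_mx1 mulmx1.
  rewrite (@eq_tens _ _ _ (fun i => rW (s i))) => [->|i]; last by rewrite fibre_base.
  by rewrite scalerA sgpK scale1r.
pose Y := (tens (fun i => A i) 1)^T *m X.
(* The rows of [Y] are the coordinates of [v]; one is nonzero, since multiplying [Y] by the basis
   matrix recovers [X]. *)
have [k0 nzk] : exists k, row k Y != 0.
  apply/existsP; apply: contraNT nzX; rewrite negb_exists => /forallP Y0.
  have Y00 : Y = 0.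
    by apply/row_matrixP=> i; have /negbNE/eqP := Y0 i; rewrite row0.
  have DP : tens (fun i => wproj rW (F i)) 1 = tens (fun i => A i) 1 *m tens (fun i => B i) 1.
    by rewrite tensM mulg1; apply: eq_tens => i; rewrite perm1 wcoordK.
  by rewrite -XP DP trmx_mul -mulmxA -/Y Y00 mulmx0.
pose k := enum_val k0; exists k; split=> [i|].
  rewrite ltnNge; apply: contra nzk => le_i; rewrite /Y row_mul.
  rewrite (_ : row k0 _ = 0) ?mul0mx //; apply/rowP=> a; rewrite !mxE.
  by rewrite (bigD1 i) //= perm1 wcoord0 // mul0r.
apply/has_semi_invP; exists (row k0 Y) => // t _ /stab_atom tk.
have sf : lift_block m t \in stab f.
  by apply/stabP=> -[i x]; rewrite lift_blockE /f /=; have [-> _] := tk i.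
have := Xf _ (lift_block_wreath m t) sf.
rewrite block_lift // (@eq_tens _ _ _ (fun _ => 1%:M)) => [|i]; last first.
  by rewrite fibre_lift repr_mx1.
rewrite sgp_lift => /(congr1 (fun M => row k0 ((tens (fun i => A i) 1)^T *m M))).
rewrite -scalemxAr [RHS]linearZ /= -/Y => <-; rewrite /Y !mulmxA -trmx_mul tensM.
rewrite !row_mul; congr (_ *m _ *m _); apply/rowP=> a; rewrite !mxE.
apply: eq_bigr => i _; rewrite mul1mx mulg1 perm1 -/k; have [Fi ->] := tk i.
by rewrite (eq_wcoord Fi).
Qed.

(** The pure tensor of the chosen basis vectors with [w] is antisymmetrized. In its coordinate at
    [k], an element contributes [w] or 0 according to whether its block permutation preserves the
    indices [k]; the identity does, so the total is a positive multiple of [w]. *)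
Lemma atoms_oslash_semi_inv (k : {ffun 'I_n -> 'I_d}) :
  (forall i, (k i < wdim rW (F i))%N) ->
  has_semi_inv rZ (odd m) (atom_colouring k) -> has_semi_inv rV true f.
Proof.
move=> kP /has_semi_invP[w nz wk].
pose k0 := enum_rank (k : D).
pose b : 'rV[rat]_#|D| := row k0 (tens (fun i => B i) 1).
pose v0 : 'rV[rat]_(#|D| * z) := tprod b w.
rewrite /has_semi_inv; apply: contraNneq nz => S0.
pose Y (u : 'rV[rat]_(#|D| * z)) := row k0 ((tens (fun i => A i) 1)^T *m tcoord u).
have YD u1 u2 : Y (u1 + u2) = Y u1 + Y u2 by rewrite /Y linearD mulmxDr linearD.
have Y0 : Y 0 = 0 by rewrite /Y linear0 mulmx0 linear0.
have YZ c u : Y (c *: u) = c *: Y u by rewrite /Y linearZ -scalemxAr linearZ.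
pose good (s : {perm 'I_n * 'I_m}) := block_perm s \in stab (atom_colouring k).
have Ys s : s \in W :&: stab f -> Y (sgp true s *: (v0 *m rV s)) = if good s then w else 0.
  case/setIP=> sW sf; have [Fs fs] := wreath_stab sW sf.
  set t := block_perm s in Fs *; pose S i := rW (fibre_perm s i).
  have tensE : tens (fun i => B i) 1 *m tens S t *m tens (fun i => A i) 1
      = (\prod_i sgp true (fibre_perm s i)) *: tens (fun i => pid_mx (wdim rW (F i))) t.
    rewrite !tensM mul1g mulg1 -tensZ; apply: eq_tens => i; rewrite perm1.
    by rewrite /S (@wbasisM _ _ _ rW _ (F i) _ (in_setT _) (fs i)) -scalemxAl (eq_wcoord (Fs i)) wbasisK.
  have -> : Y (sgp true s *: (v0 *m rV s)) = sgp true s *: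
      (((\prod_i sgp true (fibre_perm s i)) * (good s)%:R) *: (w *m rZ t)).
    rewrite YZ /Y tcoord_act tcoord_pure; congr (_ *: _).
    rewrite !mulmxA -!trmx_mul !row_mul -mulmxA; set M := row k0 _.
    suff -> : M = ((\prod_i sgp true (fibre_perm s i)) * (good s)%:R)%:M.
      by rewrite mul_scalar_mx.
    rewrite [M]mx11_scalar; congr _%:M; rewrite /M mxE mxE mulmxA -!row_mul tensE !mxE.
    congr (_ * _); rewrite enum_rankK.
    case: (boolP (good s)) => [/stab_atom kt|ngood].
      by rewrite big1 // => i _; have [_ ->] := kt i; rewrite mxE eqxx kP.
    have [i neq_i] : exists i, k (t i) != k i.
      apply/existsP; apply: contraNT ngood; rewrite negb_exists => /forallP kt.
      by apply/stab_atom=> i; split; [apply: Fs | apply/eqP/negbNE/kt].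
    rewrite (bigD1 i) //= mxE eq_sym -[(k (t i) == k i :> nat)]/(k (t i) == k i).
    by rewrite (negPf neq_i) mul0r.
  case: ifP => [gs|_]; last by rewrite mulr0 scale0r scaler0.
  rewrite (wk _ (in_setT _) gs) mulr1 !scalerA -mulrA -(sgp_wreath sW) sgpK scale1r //.
have : Y (v0 *m symm_mx rV true f) = #|[pred s in W :&: stab f | good s]|%:R *: w.
  rewrite mulmx_sumr (big_morph _ YD Y0) (eq_bigr (fun s => if good s then w else 0)).
    by rewrite -big_mkcondr sumr_const scaler_nat.
  by move=> s /Ys <-; rewrite scalemxAr.
rewrite S0 mulmx0 Y0 => /esym/eqP; rewrite scaler_eq0 pnatr_eq0.
case/orP=> //; rewrite -leqn0 leqNgt => /negP[]; apply/card_gt0P; exists 1%g.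
by rewrite unfold_in /= group1 /good block_perm1 group1.
Qed.

End OslashSemiInv.

(** * Minimal costs of generalized Foulkes modules *)

Section MonoColouring.

Variables (m N : nat).
Implicit Types p q : 'I_m -> 'I_N.

(** Weakly increasing colourings serve as normal forms of the orbits of ['S_m] on colourings of one
    block, as [F_normal] requires. *)
Definition mono_col p := [forall x : 'I_m, forall y : 'I_m, (x <= y)%N ==> (p x <= p y)%N].

Lemma mono_colP p : reflect (forall x y : 'I_m, (x <= y)%N -> (p x <= p y)%N) (mono_col p).
Proof.
apply: (iffP forallP) => pP x; last by apply/forallP=> y; apply/implyP/pP.
by move=> y; have /forallP/(_ y)/implyP := pP x.
Qed.

Lemma mono_col_eq p q (s : 'S_m) :
  mono_col p -> mono_col q -> (forall x, q (s x) = p x) -> q =1 p.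
Proof.
have so r : mono_col r -> sorted leq [seq (r x : nat) | x <- enum 'I_m].
  move/mono_colP=> r_mono.
  have: sorted (relpre val leq) (enum 'I_m).
    by rewrite -sorted_map val_enum_ord iota_sorted.
  by apply: homo_sorted => x y; apply: r_mono.
move=> /so sp /so sq qs.
have: [seq (q x : nat) | x <- enum 'I_m] = [seq (p x : nat) | x <- enum 'I_m].
  apply: (sorted_eq leq_trans anti_leq) => //.
  rewrite (eq_map (fun x => congr1 val (esym (qs x)))) perm_sym.
  rewrite (map_comp (fun x => q x : nat) s) perm_map //.
  apply: uniq_perm; rewrite ?(map_inj_uniq (@perm_inj _ s)) ?enum_uniq // => x.
  rewrite mem_enum; apply/mapP; exists ((s^-1)%g x); rewrite ?mem_enum ?permKV //.
by move/eq_in_map=> eq_pq x; apply/ord_inj/eq_pq; rewrite mem_enum.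
Qed.

Lemma mono_col_ex p : exists s : 'S_m, mono_col (p \o s).
Proof.
pose le_ord (a b : 'I_N) := (a <= b)%N.
pose t := [tuple p x | x < m].
have pt : perm_eq (sort le_ord t) t by rewrite perm_sort.
have size_t : size (sort le_ord t) == m by rewrite size_sort size_tuple.
have /tuple_permP[s Ds] : perm_eq (Tuple size_t) t by [].
exists s; apply/mono_colP=> x y le_xy /=.
have le_tr : transitive le_ord by move=> a b c; apply: leq_trans.
have le_tot : total le_ord by move=> a b; apply: leq_total.
have ts := sort_sorted le_tot t.
have nthE (z : 'I_m) : p (s z) = nth (p x) (sort le_ord t) z.
  have := congr1 (fun u => nth (p x) u z) Ds => /= ->.
  by rewrite (nth_map z) ?size_enum_ord // nth_ord_enum tnth_mktuple.
have le_rfl : reflexive le_ord by move=> a; apply: leqnn.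
rewrite !nthE; apply: (sorted_leq_nth le_tr le_rfl (p x) ts _ _ _ _ le_xy); by rewrite inE (eqP size_t).
Qed.

End MonoColouring.

Section Atoms.

Variables (m N n0 : nat) (U : representation rat [set: 'S_m]).
Hypotheses (m_gt0 : (0 < m)%N) (U_gt0 : (0 < rdegree U)%N) (leN : (n0 * m <= N)%N).
Local Notation d := (rdegree U).
Local Notation atomT := ({ffun 'I_m -> 'I_N} * 'I_d)%type.

Definition atom_cost (p : atomT) : nat := cost p.1.

Definition is_atom (p : atomT) := mono_col p.1 && (p.2 < wdim U p.1)%N.

Definition atoms : seq atomT :=
  sort (fun p q => (atom_cost p <= atom_cost q)%N) (enum is_atom).

Lemma mem_atoms p : (p \in atoms) = is_atom p.
Proof. by rewrite mem_sort mem_enum. Qed.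

Lemma atoms_uniq : uniq atoms.
Proof. by rewrite sort_uniq enum_uniq. Qed.

Definition nth_cost (i : nat) : nat := nth 0%N [seq atom_cost p | p <- atoms] i.

Lemma nth_cost_mono i j : (i <= j)%N -> (j < size atoms)%N -> (nth_cost i <= nth_cost j)%N.
Proof.
move=> le_ij lt_j.
have so : sorted leq [seq atom_cost p | p <- atoms].
  by rewrite sorted_map; apply: sort_sorted => p q; apply: leq_total.
apply: (sorted_leq_nth leq_trans leqnn 0%N so) => //; rewrite inE size_map //.
exact: leq_ltn_trans lt_j.
Qed.

Lemma nth_cost_index p : p \in atoms -> nth_cost (index p atoms) = atom_cost p.
Proof. by move=> ap; rewrite /nth_cost (nth_map p) ?index_mem // nth_index. Qed.

(** The colourings [x |-> j * m + x] for [j < n0] are increasing, distinct and injective. For an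
    injective colouring every vector of [U] is semi-invariant, so basis index 0 gives an atom. *)
Lemma size_atoms : (n0 <= size atoms)%N.
Proof.
have lt_jx (j : 'I_n0) (x : 'I_m) : (j * m + x < N)%N.
  apply: leq_trans leN; apply: (@leq_trans (j.+1 * m)); last by rewrite leq_mul2r ltn_ord orbT.
  by rewrite mulSn addnC ltn_add2r.
pose a (j : 'I_n0) : atomT := ([ffun x => Ordinal (lt_jx j x)], Ordinal U_gt0).
have a_inj : injective a.
  move=> i j [/ffunP/(_ (Ordinal m_gt0))]; rewrite !ffunE => /(congr1 val) /= /eqP.
  by rewrite !addn0 eqn_pmul2r // => /eqP/ord_inj.
have u : uniq [seq a j | j <- enum 'I_n0] by rewrite map_inj_uniq ?enum_uniq.
suff sub : {subset [seq a j | j <- enum 'I_n0] <= atoms}.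
  by have := uniq_leq_size u sub; rewrite size_map size_enum_ord.
move=> _ /mapP[j _ ->]; rewrite mem_atoms; apply/andP; split.
  by apply/mono_colP=> x y; rewrite !ffunE leq_add2l.
rewrite /= lt0n mxrank_eq0 scaler_eq0 negb_or invr_eq0 card_GIstab_neq0 /=.
apply: (has_semi_inv_inj U true _ U_gt0) => x y.
by rewrite !ffunE => /(congr1 val) /= /addnI/ord_inj.
Qed.

Definition row_cost (r : nat) : nat := \sum_(j < r) nth_cost j.

Section FoulkesCost.

Variables (n : nat) (nu : seq nat).
Hypotheses (nu_part : is_partition n nu) (n_gt0 : (0 < n)%N) (le_n : (n <= n0)%N).
Local Notation Z := (specht 'I_n nu).
Local Notation H := (ind_repr (subsetT (wreath m n)) (oslash U Z)).

Let nu_sorted : sorted geq nu := is_partition_sorted nu_part.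

Lemma mono_normal (F : 'I_n -> 'I_m -> 'I_N) :
  (forall i, mono_col (F i)) ->
  forall i j (s : 'S_m), (forall x, F j (s x) = F i x) -> F j =1 F i.
Proof. by move=> Fm i j s; apply: mono_col_eq. Qed.

(** After translation by a coset representative and sorting inside each block, a present colouring
    yields atoms on the blocks. Their indices in [atoms] colour the blocks, and [specht_upper]
    bounds the total. *)
Lemma foulkes_cost_ge (g : {ffun 'I_n * 'I_m -> 'I_N}) :
  has_semi_inv H true g ->
  (\sum_(r <- lines (odd m) nu) row_cost r <= cost g)%N.
Proof.
case/ind_semi_inv=> s _ gs.
have ex i : exists u : 'S_m, mono_col (fun x => g (s (i, u x))).
  by have [u] := mono_col_ex (fun x => g (s (i, x))); exists u.
have exb i : exists u : 'S_m, mono_col [ffun x => g (s (i, u x))].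
  by have [u /mono_colP um] := ex i; exists u; apply/mono_colP=> x y; rewrite !ffunE; apply: um.
pose u i := xchoose (exb i).
pose F i : {ffun 'I_m -> 'I_N} := [ffun x => g (s (i, u i x))].
have Fm i : mono_col (F i) := xchooseP (exb i).
have VF : has_semi_inv (oslash U Z) true (block_colouring (fun i => F i)).
  have := has_semi_inv_comp (base_perm_wreath u) gs.
  apply: has_semi_inv_sub => -[i x] [j y]; rewrite /block_colouring /= !ffunE.
  by rewrite !base_permE.
have [k [kP Zk]] := oslash_semi_inv_atoms m_gt0 VF.
pose a i : atomT := (F i, k i).
have aP i : a i \in atoms by rewrite mem_atoms /is_atom Fm kP.
have Zb : has_semi_inv Z (odd m) (fun i => index (a i) atoms).
  apply: has_semi_inv_sub Zk => i j /(congr1 (nth (a i) atoms)).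
  rewrite !nth_index // => -[Fij kij]; congr (_, _) => //.
  by apply/ffunP=> x; rewrite [LHS]ffunE [RHS]ffunE Fij.
apply: leq_trans (specht_upper nu_sorted Zb nth_cost_mono _) _ => [i|].
  by rewrite index_mem.
rewrite (eq_bigr (fun i => \sum_x N ^ g (s (i, u i x)))%N) => [|i _]; last first.
  by rewrite nth_cost_index // /atom_cost /cost; apply: eq_bigr => x _; rewrite ffunE.
rewrite pair_bigA /= -(cost_comp g s) -(cost_comp (g \o s) (base_perm u)).
by apply: eq_leq; apply: eq_bigr => -[i x] _; rewrite /= base_permE.
Qed.

(** Block [i] receives the atom of index [c i], with [c] the colouring from [specht_lower]; enough
    atoms exist by [size_atoms]. *)
Lemma foulkes_cost_eq : exists2 g : {ffun 'I_n * 'I_m -> 'I_N},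
  has_semi_inv H true g & cost g = (\sum_(r <- lines (odd m) nu) row_cost r)%N.
Proof.
have [t _] : exists t : tableau 'I_n nu, True by apply: tableau_ex; rewrite card_ord.
have [c Zc [lt_c sum_c]] := specht_lower nu_sorted (odd m) t.
have lt_c' i : (c i < size atoms)%N.
  by apply: leq_trans (lt_c i) _; rewrite card_ord (leq_trans le_n) ?size_atoms.
case Da: atoms => [|p0 ps]; first by have := lt_c' (Ordinal n_gt0); rewrite Da.
pose a i := nth p0 atoms (c i).
have aP i : is_atom (a i) by rewrite -mem_atoms mem_nth.
pose F i : {ffun 'I_m -> 'I_N} := (a i).1; pose k := [ffun i => (a i).2].
have Fm i : mono_col (F i) by have /andP[] := aP i.
exists [ffun x => F x.1 x.2].
  have : has_semi_inv (oslash U Z) true (block_colouring (fun i => F i)).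
    apply: (@atoms_oslash_semi_inv _ _ _ _ U Z _ (fun i => F i) (mono_normal Fm) k).
      by move=> i; rewrite ffunE; have /andP[] := aP i.
    apply: has_semi_inv_sub Zc => i j; rewrite /atom_colouring !ffunE => -[Fij kij].
    have: a i = a j.
      rewrite [a i]surjective_pairing [a j]surjective_pairing kij; congr (_, _).
      by apply/ffunP=> x; have /ffunP/(_ x) := Fij; rewrite !ffunE.
    by move/eqP; rewrite nth_uniq ?atoms_uniq // => /eqP.
  move/(semi_inv_ind (subsetT (wreath m n))).
  by apply: has_semi_inv_sub => x y; rewrite !ffunE.
rewrite -sum_c /cost.
rewrite (eq_bigr (fun x : 'I_n * 'I_m => N ^ F x.1 x.2)%N) => [|x _]; last by rewrite ffunE.
rewrite -(pair_bigA _ (fun i x => N ^ F i x)%N) /=; apply: eq_bigr => i _.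
by rewrite /nth_cost (nth_map p0).
Qed.

End FoulkesCost.

End Atoms.

(** * Least constituents and their joins *)

Local Open Scope nat_scope.

Definition one_line (e : bool) (r : nat) : seq nat := if e then [:: r] else nseq r 1.

Lemma one_line_partition e r : 0 < r -> is_partition r (one_line e r).
Proof.
move=> r_gt0; case: e; first by rewrite /is_partition /= inE eq_sym -lt0n r_gt0 addn0 eqxx.
apply/and3P; split.
- by apply/(sortedP 0) => i; rewrite size_nseq => lt_i; rewrite !nth_nseq lt_i (ltnW lt_i).
- by apply/negP=> /nseqP[].
by rewrite sumn_nseq mul1n.
Qed.

Lemma lines_one_line e r : 0 < r -> lines e (one_line e r) = [:: r].
Proof.
case: e; case: r => // r _.
by rewrite /lines /one_line /conj_part /= count_nseq mul1n.
Qed.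

Lemma lines_gt0 e n nu r : is_partition n nu -> r \in lines e nu -> 0 < r.
Proof.
case/and3P=> _ nu0 _; case: e => [rnu|/mapP[j]].
  by rewrite lt0n; apply: contraNneq nu0 => <-.
rewrite mem_iota add0n /= => lt_j ->; rewrite -has_count.
by case: nu lt_j {nu0} => //= a nu ->.
Qed.

Lemma sumn_lines e n nu : is_partition n nu -> sumn (lines e nu) = n.
Proof.
move=> nu_part; have ns := is_partition_sorted nu_part.
case: e; first by have /and3P[_ _ /eqP] := nu_part.
have [t _] : exists t : tableau 'I_n nu, True by apply: tableau_ex; rewrite card_ord.
have := sum_lines (tableau_card_col ns t) (fun=> 1).
rewrite sum1_card card_ord => ->; rewrite sumnE -(sum_parts _ id).
by apply: eq_bigr => i _; rewrite sum1_card (tableau_card_col ns t).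
Qed.

Lemma sumn_mem (s : seq nat) x : x \in s -> x <= sumn s.
Proof. by move=> xs; rewrite sumnE (big_rem x) //= leq_addr. Qed.

(** Induction along the list replaces an axiom of choice, as the witnesses exist only in [Prop]. *)
Lemma finite_choice (A : Type) (a0 : A) (P : nat -> A -> Prop) (s : seq nat) :
  (forall r, r \in s -> exists a, P r a) -> exists l : nat -> A, forall r, r \in s -> P r (l r).
Proof.
elim: s => [|r s IH] ex; first by exists (fun=> a0).
have [l lP] := IH (fun q qs => ex q (mem_behead (s := r :: s) qs)).
have [a Pa] := ex r (mem_head _ _).
exists (fun q => if q == r then a else l q) => q; rewrite inE.
by case: eqP => [-> _|_ /lP].
Qed.

(** The bound on [N] involves [n0] rather than [n], so that costs for all line lengths up to [n0]
    are measured in one base. *)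
Lemma lex_least_ex m mu n0 n nu N (U := specht 'I_m mu) :
  0 < m -> is_partition m mu -> 0 < n -> n <= n0 -> is_partition n nu -> n0 * m < N ->
  exists2 lam, lex_least_constituent m n mu nu lam &
    is_partition (n * m) lam /\
    part_cost N lam = \sum_(r <- lines (odd m) nu) row_cost N U r.
Proof.
move=> m_gt0 mu_part n_gt0 le_n nu_part ltN.
have [tU _] : exists t : tableau 'I_m mu, True by apply: tableau_ex; rewrite card_ord.
have U_gt0 : 0 < rdegree U := specht_rank_gt0 tU (is_partition_sorted mu_part).
have cardT : #|{: 'I_n * 'I_m}| = n * m by rewrite card_prod !card_ord.
have ltTN : n * m < N by apply: leq_ltn_trans ltN; rewrite leq_mul2r le_n orbT.
have [g Hg cost_g] := foulkes_cost_eq m_gt0 U_gt0 (ltnW ltN) nu_part n_gt0 le_n.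
have ge := foulkes_cost_ge m_gt0 nu_part.
have ming : min_cost (foulkes m n mu nu) true g.
  by split=> // g' Hg'; rewrite cost_g; apply: ge.
have leTN : #|{: 'I_n * 'I_m}| <= N by rewrite cardT ltnW.
have [lam occ cost_lam] := min_cost_occurs leTN ming.
have lamP : is_partition (n * m) lam by rewrite -cardT; case: occ.
exists lam; last by rewrite cost_lam cost_g.
split=> // kap occk; have [f Hf cost_f] := occurs_cost leTN occk.
have kapP : is_partition (n * m) kap by rewrite -cardT; case: occk.
apply: (part_cost_lex (is_partition_good ltTN lamP) (is_partition_good ltTN kapP)).
by rewrite cost_lam -cost_f; case: ming => _; apply.
Qed.

(** The join of the least constituents of the lines has the sum of their costs, which is the cost of
    the least constituent for [nu]; equal costs force equal partitions. *)
Lemma lex_least_join m n mu nu :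
  0 < m -> 0 < n -> is_partition m mu -> is_partition n nu ->
  exists2 lam : nat -> seq nat,
    (forall r, r \in lines (odd m) nu ->
       lex_least_constituent m r mu (one_line (odd m) r) (lam r)) &
    lex_least_constituent m n mu nu (join_parts [seq lam r | r <- lines (odd m) nu]).
Proof.
move=> m_gt0 n_gt0 mu_part nu_part; pose N := (n * m).+1.
pose U := specht 'I_m mu; set L := lines _ _.
have sumL : sumn L = n := sumn_lines (odd m) nu_part.
have L_gt0 r : r \in L -> 0 < r by move=> rL; apply: lines_gt0 nu_part rL.
have [lam lamP] : exists lam : nat -> seq nat, forall r, r \in L ->
    lex_least_constituent m r mu (one_line (odd m) r) (lam r) /\
    is_partition (r * m) (lam r) /\ part_cost N (lam r) = row_cost N U r.
  apply: (finite_choice (P := fun r l => lex_least_constituent m r mu (one_line (odd m) r) l /\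
    is_partition (r * m) l /\ part_cost N l = row_cost N U r) [::]) => r rL.
  have le_r : r <= n by rewrite -sumL sumn_mem.
  have r_gt0 := L_gt0 r rL.
  have [l lP [lpart lcost]] := lex_least_ex m_gt0 mu_part r_gt0 le_r
    (one_line_partition (odd m) r_gt0) (ltnSn (n * m)).
  by exists l; rewrite lines_one_line // big_seq1 in lcost.
exists lam; first by move=> r /lamP[].
have [l0 l0P [l0part l0cost]] := lex_least_ex m_gt0 mu_part n_gt0 (leqnn n) nu_part (ltnSn (n * m)).
suff -> : join_parts [seq lam r | r <- L] = l0 by [].
apply: (@part_cost_inj N).
- apply: join_parts_good => [s /mapP[r /lamP[_ [/and3P[_ s0 _] _]] -> //]|].
  rewrite big_map big_seq (eq_bigr (fun r => r * m)) => [|r /lamP[_ [/and3P[_ _ /eqP] //]]].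
  by rewrite -big_seq -big_distrl /= -sumnE sumL.
- exact: is_partition_good l0part.
rewrite l0cost part_cost_join big_map big_seq [RHS]big_seq; apply: eq_bigr => r rL.
by have [_ []] := lamP r rL.
Qed.

Theorem corollary9p3 (m n : nat) (mu nu : seq nat)
    (m_gt0 : 0 < m) (n_gt0 : 0 < n)
    (mu_part : is_partition m mu) (nu_part : is_partition n nu) :
  (odd m ->
     exists2 lam : nat -> seq nat,
       (forall r, r \in nu -> lex_least_constituent m r mu [:: r] (lam r))
       & lex_least_constituent m n mu nu (join_parts [seq lam r | r <- nu]))
  /\
  (~~ odd m ->
     exists2 lam : nat -> seq nat,
       (forall r, r \in conj_part nu ->
          lex_least_constituent m r mu (nseq r 1) (lam r))
       & lex_least_constituent m n mu nu
           (join_parts [seq lam r | r <- conj_part nu])).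
Proof.
have H := lex_least_join m_gt0 n_gt0 mu_part nu_part.
by split=> parity; [rewrite parity in H | rewrite (negPf parity) in H].
Qed.
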